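(* Let $k$ be an algebraically closed field containing $\kappa$, let $(I,\mathbf\Lambda)$ be a Bruhat–Tits index, and let $(A_m\subset\dots\subset A_1\subset B_1\subset\dots\subset B_m)\in\mathcal N^{\mathbf h}_{E/F}(k)$. The following statements are equivalent. 1. $(A_m\subset\dots\subset B_m)\in\mathcal N^{\mathbf h,0}_{I,\mathbf\Lambda}(k)$. 2. $I$ is the Bruhat–Tits type of $(A_m\subset\dots\subset B_m)$, and for all $i\in I\setminus\{0\}$ and $j\in I\setminus\{m\}$ we have $\Lambda_0^i=\Lambda_{B_i}$ and $\Lambda_1^j=\Lambda_{A_{j+1}}$.
   Context: Fields. $p$ is an odd prime, $F/\mathbb Q_p$ a finite extension with ring of integers $\mathcal O_F$, uniformizer $\pi$, residue field $\mathbb F_q$; $E/F$ is the unramified quadratic extension with nontrivial automorphism $x\mapsto x^*$; $\breve E$ is the completion of the maximal unramified extension of $E$, with residue field $\kappa=\overline{\mathbb F}_{q}$. For a perfect field $R\supset\mathbb F_q$, $W_{\mathcal O_F}(R)$ is the ring of relative Witt vectors, $F_R$ its fraction field, $\sigma$ the lift of $x\mapsto x^q$. Fix $n,m\ge 1$ and integers $\mathbf h=(h_1<\dots<h_m)$, $0\le h_i\le n$, all of the same parity. Framing objects. A strict formal $\mathcal O_F$-module is a formal $p$-divisible group with $\mathcal O_F$-action inducing the natural action on its Lie algebra. For $h\in\{h_1,\dots,h_m\}$ fix $\mathbb X^{[h]}=(\mathbb X,i_{\mathbb X},\lambda^{[h]})$: $\mathbb X$ a supersingular strict formal $\mathcal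 O_F$-module over $\mathbb F_{q^2}$ of relative $F$-height $2n$; $i_{\mathbb X}$ an $\mathcal O_E$-action extending the $\mathcal O_F$-action with $\mathrm{charpol}(i_{\mathbb X}(x)\mid\mathrm{Lie})=(T-x)(T-x^* )^{n-1}$; $\lambda^{[h]}$ an $\mathcal O_E$-linear polarization (the dual having the action $i_{\mathbb X}(x^* )^\vee$) with kernel contained in $\mathbb X[\pi]$ of order $q^{2h}$. For $h<h'$ among the $h_i$ fix isogenies $\alpha_{h',h}:\mathbb X^{[h']}\to\mathbb X^{[h]}$, compatible with composition, $\mathcal O_E$-actions and polarizations (inducing isometries of Dieudonné isocrystals), with kernel in the $\pi$-torsion of order $q^{h'-h}$; $\alpha_{h,h}=\mathrm{id}$. Moduli space. For an $\mathcal O_E$-scheme $S$ on which $\pi$ is locally nilpotent, with $\bar S=S\times_{\mathcal O_F}\mathbb F_q$, $\mathcal N^h(S)$ is the set of isomorphism classes of $(X,i_X,\lambda_X,\rho_X)$: $X$ a strict formal $\mathcal O_F$-module over $S$ of relative height $2n$, $i_X$ an $\mathcal O_E$-action extending the $\mathcal O_F$-action with $\mathrm{charpol}(i_X(x)\mid\mathrm{Lie}X)=(T-x)(T-x^* )^{n-1}$, $\lambda_X$ an $\mathcal O_E$-linear polarization, $\rho_X:X_{\bar S}\to\mathbb X^{[h]}_{\bar S}$ an $\mathcal O_E$-linear quasi-isogeny of height $0$ with $\rho_X^\vee\lambda^{[h]}\rho_X=\lambda_X$ up to a scalar in $\mathcal O_F^\times$. $\mathcal N^{\mathbf h}(S)$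 is the set of tuples $(X^{[i]},i_{X^{[i]}},\lambda_{X^{[i]}},\rho_{X^{[i]}})_{1\le i\le m}$ (up to isomorphism) of elements of $\mathcal N^{h_i}(S)$ such that $\rho_{X^{[i]}}^{-1}\circ\alpha_{h_{i+1},h_i}\circ\rho_{X^{[i+1]}}$ lifts to an isogeny $X^{[i+1]}\to X^{[i]}$ for $1\le i<m$. After base change to $\mathcal O_{\breve E}$ it is represented by a formal scheme $\mathcal N^{\mathbf h}_{E/F}$; $\mathcal N^{\mathbf h}_{E/F,\mathrm{red}}$ is the reduced special fiber, over $\kappa$. Hermitian space. Let $\mathbb N$ be the rational relative Dieudonné module of $\mathbb X^{[h_1]}$, with $\mathcal F,\mathcal V$ ($\mathcal F\mathcal V=\pi$) and pairing $\langle\cdot,\cdot\rangle$ induced by $\lambda^{[h_1]}$, with $\langle\mathcal Fv,w\rangle=\langle v,\mathcal Vw\rangle^\sigma$ and $\langle i(x)v,w\rangle=\langle v,i(x^* )w\rangle$. For $k\supset\kappa$ algebraically closed, $\mathbb N_k=\mathbb N\otimes F_k=\mathbb N_{k,0}\oplus\mathbb N_{k,1}$, where $E$ acts on $\mathbb N_{k,0}$ via a fixed $F$-isomorphism $\varphi_0:E\simeq F_{\mathbb F_{q^2}}$ and on $\mathbb N_{k,1}$ via its conjugate. Put $\tau=\pi\mathcal V^{-2}$ and $C=\mathbb N_{k,0}^\tau$, an $n$-dimensional $F_{\mathbb F_{q^2}}$-space independent of $k$, with $C_k:=C\otimes F_k=\mathbb N_{k,0}$, $\tau=\mathrm{id}\otimes\sigma^2$.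 The form $\{v,w\}=\delta\langle v,\mathcal Fw\rangle$ (fixed $\delta\in W_{\mathcal O_F}(\mathbb F_{q^2})^\times$, $\delta^\sigma=-\delta$) is left linear, right $\sigma$-linear, nondegenerate on $C_k$, hermitian on $C$. For a lattice $A$, $A^\vee$ is the set of $v$ with $\{v,A\}$ integral. $A\overset{x}{\subset}B$ means $A\subset B$ with $B/A$ of length $x$. $\Lambda_k=\Lambda\otimes W_{\mathcal O_F}(k)$ for a lattice $\Lambda\subset C$. Points. By relative Dieudonné theory $\mathcal N^{\mathbf h}_{E/F}(k)$ is identified with the set of chains of $W_{\mathcal O_F}(k)$-lattices $A_m\subset\dots\subset A_1\subset B_1\subset\dots\subset B_m$ in $C_k$ such that for all $i$: $\pi A_i^\vee\overset{1}{\subset}B_i\subset A_i^\vee$, $\pi B_i^\vee\overset{1}{\subset}A_i\subset B_i^\vee$, $\pi B_i\subset A_i\overset{h_i}{\subset}B_i$. Vertex lattices. $\mathcal L_i$ is the set of $W_{\mathcal O_F}(\mathbb F_{q^2})$-lattices $\Lambda\subset C$ with $\pi^{i+1}\Lambda^\vee\subset\Lambda\subset\pi^i\Lambda^\vee$; the type of $\Lambda\in\mathcal L_i$ is $t(\Lambda)=[\Lambda:\pi^{i+1}\Lambda^\vee]$; $\mathcal L_i^{\ge x}=\{\Lambda\in\mathcal L_i: t(\Lambda)\ge x\}$. Bruhat–Tits type. For a lattice $M\subset C_k$ put $T_s(M)=M+\tau(M)+\dots+\tau^{s-1}(M)$; for the $A_i,B_i$ above this is $\tau$-stable for $s$ large.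 $\Lambda_{A_i},\Lambda_{B_i}\subset C$ are the lattices with $(\Lambda_{A_i})_k=T_s(A_i)$, $(\Lambda_{B_i})_k=T_s(B_i)$ for $s$ large. The Bruhat–Tits type of the point is the subset of $\{0,\dots,m\}$ containing $0$ iff $\Lambda_{A_1}\in\mathcal L_1$, containing $m$ iff $\Lambda_{B_m}\in\mathcal L_0$, and containing $1\le i\le m-1$ iff $\Lambda_{B_i}\subset\pi\Lambda_{A_{i+1}}^\vee$. Bruhat–Tits index. A pair $(I,\mathbf\Lambda)$: $I$ a non-empty subset of $\{0,\dots,m\}$ with $0\notin I$ if $h_1=0$ and $m\notin I$ if $h_m=n$; $\mathbf\Lambda$ a collection of $\Lambda_0^i\in\mathcal L_0^{\ge h_i+1}$ for $i\in I\setminus\{0\}$ and $\Lambda_1^j\in\mathcal L_1^{\ge n-h_{j+1}+1}$ for $j\in I\setminus\{m\}$ such that, writing $I=\{i_1<\dots<i_s\}$, $\Lambda_0^{i_1}\subset\pi\Lambda_1^{i_1\vee}\subset\Lambda_0^{i_2}\subset\pi\Lambda_1^{i_2\vee}\subset\dots\subset\Lambda_0^{i_s}\subset\pi\Lambda_1^{i_s\vee}$, where the first term is omitted if $i_1=0$ and the last term is omitted if $i_s=m$. $(I',\mathbf\Lambda')\subset(I,\mathbf\Lambda)$ means: $I\subset I'$, $\Lambda_0'^{i}\subset\Lambda_0^i$ for all $i\in I\setminus\{0\}$, $\Lambda_1'^{j}\subset\Lambda_1^j$ for all $j\in I\setminus\{m\}$. Strata. For $i\in I\setminus\{0\}$ and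 $j\in I\setminus\{m\}$ put $\Lambda_0^{i-}=\alpha_{h_i,h_1}^{-1}(\pi\Lambda_0^{i\vee}\oplus\mathcal V(\Lambda_0^{i\vee}))$ and $\Lambda_1^{j+}=\alpha_{h_{j+1},h_1}^{-1}(\Lambda_1^j\oplus\mathcal V^{-1}(\Lambda_1^j))$, the Dieudonné modules of strict formal $\mathcal O_F$-modules with quasi-isogenies $\rho_{\Lambda_0^{i-}}$, $\rho_{\Lambda_1^{j+}}$ over $\kappa$ to $\mathbb X^{[h_i]}$, $\mathbb X^{[h_{j+1}]}$. $\mathcal N^{\mathbf h}_{I,\mathbf\Lambda}$ is the projective closed subscheme of $\mathcal N^{\mathbf h}_{E/F,\mathrm{red}}$ representing the points over $\kappa$-schemes $S$ for which all $\rho_{X^{[i]}}^{-1}\circ(\rho_{\Lambda_0^{i-}})_S$ ($i\in I\setminus\{0\}$) and $(\rho_{\Lambda_1^{j+}})_S^{-1}\circ\rho_{X^{[j+1]}}$ ($j\in I\setminus\{m\}$) are isogenies. Its $k$-points are the lattice chains with $B_i\subset(\Lambda_0^i)_k$ for $i\in I\setminus\{0\}$ and $A_{j+1}\subset(\Lambda_1^j)_k$ for $j\in I\setminus\{m\}$. Finally $\mathcal N^{\mathbf h,0}_{I,\mathbf\Lambda}=\mathcal N^{\mathbf h}_{I,\mathbf\Lambda}\setminus\bigcup_{(I',\mathbf\Lambda')\subsetneq(I,\mathbf\Lambda)}\mathcal N^{\mathbf h}_{I',\mathbf\Lambda'}$. *)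

(* Defs.v *)
From HB Require Import structures.
From mathcomp Require Import all_boot all_order all_algebra all_field.
From mathcomp Require Import all_classical.

Set Implicit Arguments.
Unset Strict Implicit.
Unset Printing Implicit Defensive.

Import GRing.Theory.
Local Open Scope classical_set_scope.
Local Open Scope ring_scope.

(** * Integral closures *)

Section IntegralClosure.
Variables (A : comNzRingType) (K : fieldType) (f : {rmorphism A -> K}).

Definition int_closure : {pred K} := fun x => `[<integralOver f x>].

Lemma int_closure_subring : subring_closed int_closure.
Proof.
have E x : (x \in int_closure) = `[<integralOver f x>] by [].
split=> [|x y|x y]; rewrite !E.
- by apply/asboolP; exact: (integral1 f).
- by move=> /asboolP hx /asboolP hy; apply/asboolP; exact: integral_sub.
- by move=> /asboolP hx /asboolP hy; apply/asboolP; exact: integral_mul.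
Qed.

HB.instance Definition _ :=
  GRing.isSubringClosed.Build K int_closure int_closure_subring.

Record int_ring := IntRing { int_val :> K; int_valP : int_val \in int_closure }.

HB.instance Definition _ := [isSub for int_val].
HB.instance Definition _ := [Choice of int_ring by <:].
HB.instance Definition _ := [SubChoice_isSubComNzRing of int_ring by <:].

End IntegralClosure.

(** * Local fields and relative Witt vectors *)

(* [red] exhibits [R] as [W / t W], and [W] is [t]-torsion free, [t]-adically
   separated and [t]-adically complete. *)
Record strict_ring (W : comNzRingType) (t : W) (R : fieldType)
    (red : {rmorphism W -> R}) : Prop := {
  strict_surj : forall y, exists x, red x = y;
  strict_ker : forall x, red x = 0 <-> exists y, x = t * y;
  strict_torsion : forall x, t * x = 0 -> x = 0;
  strict_separated : forall x, (forall j, exists y, x = t ^+ j * y) -> x = 0;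
  strict_complete : forall u : nat -> W,
    (forall j, exists y, u j.+1 - u j = t ^+ j * y) ->
    exists x, forall j, exists y, x - u j = t ^+ j * y
}.

(* The ring of p-adic integers is the p-torsion free, p-adically complete ring
   with residue field F_p; a p-adic field is a finite extension of its fraction
   field, and its ring of integers is the integral closure of Z_p. *)
Record padic_field (p : nat) := PadicField {
  Zp : idomainType;
  Zp_red : {rmorphism Zp -> 'F_p};
  Zp_strict : strict_ring (p%:R : Zp) Zp_red;
  pF :> fieldExtType {fraction Zp};
  OF := int_ring (in_alg pF \o @tofrac Zp);
  unif : OF;
  resF : finFieldType;
  redF : {rmorphism OF -> resF};
  redF_surj : forall y, exists x, redF x = y;
  redF_ker : forall x, redF x = 0 <-> exists y, x = unif * y
}.

(* An unramified quadratic extension: the uniformizer of the base stays a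
   uniformizer, and the residue field becomes quadratic. *)
Record unramified_quadratic (p : nat) (K : padic_field p) := UnramifiedQuadratic {
  qE :> fieldExtType K;
  qE_dim : \dim {:qE} = 2%N;
  star : {rmorphism qE -> qE};
  star_id : forall a : K, star a%:A = a%:A;
  star_neq : exists x, star x <> x;
  OE := int_ring (in_alg qE \o (in_alg K \o @tofrac (Zp K)));
  resE : finFieldType;
  redE : {rmorphism OE -> resE};
  redE_surj : forall y, exists x, redE x = y;
  redE_ker : forall x : OE,
    redE x = 0 <-> exists y : OE, int_val x = (int_val (unif K))%:A * int_val y;
  res_incl : {rmorphism resF K -> resE};
  redE_incl : forall (a : OF K) (x : OE),
    int_val x = (int_val a)%:A -> redE x = res_incl (redF K a);
  resE_card : #|resE| = (#|resF K| ^ 2)%N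
}.

(* For perfect [R], the ring W_O(R) of relative Witt vectors is the strict
   O-algebra with residue ring [R], unique up to unique isomorphism. *)
Record relative_witt (O : comNzRingType) (t : O) (R : fieldType)
    (resO : {rmorphism O -> R}) := RelativeWitt {
  witt :> idomainType;
  witt_alg : {rmorphism O -> witt};
  witt_red : {rmorphism witt -> R};
  witt_alg_red : forall a, witt_red (witt_alg a) = resO a;
  witt_strict : strict_ring (witt_alg t) witt_red
}.

(* [Wq2] and [Wk] are the relative Witt vectors of F_{q^2} (the residue field of
   E) and of k; [Fq2] and [Fk] are their fraction fields. *)
Record base_data (p : nat) := BaseData {
  bF :> padic_field p;
  bE : unramified_quadratic bF;
  kappa : closedFieldType;
  kappa_incl : {rmorphism resE bE -> kappa};
  kappa_alg : forall x, algebraicOver kappa_incl x;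
  bk : closedFieldType;
  bk_incl : {rmorphism kappa -> bk};
  Wq2 : relative_witt (unif bF) (res_incl bE \o @redF p bF);
  Wk : relative_witt (unif bF)
         (bk_incl \o (kappa_incl \o (res_incl bE \o @redF p bF)));
  witt_map : {rmorphism Wq2 -> Wk};
  witt_map_alg : forall a, witt_map (witt_alg Wq2 a) = witt_alg Wk a;
  witt_map_red : forall x,
    witt_red Wk (witt_map x) = bk_incl (kappa_incl (witt_red Wq2 x));
  Fq2 := {fraction Wq2};
  Fk := {fraction Wk};
  frac_map : {rmorphism Fq2 -> Fk};
  frac_mapE : forall x : Wq2, frac_map (tofrac x) = tofrac (witt_map x);
  wsigma : {rmorphism Wk -> Wk};
  wsigma_alg : forall a, wsigma (witt_alg Wk a) = witt_alg Wk a;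
  wsigma_red : forall x, witt_red Wk (wsigma x) = witt_red Wk x ^+ #|resF bF|;
  sigma : {rmorphism Fk -> Fk};
  sigmaE : forall x : Wk, sigma (tofrac x) = tofrac (wsigma x);
  phi0 : {rmorphism bE -> Fq2};
  phi0_bij : bijective phi0;
  phi0_alg : forall a : OF bF,
    phi0 (int_val a)%:A = tofrac (witt_alg Wq2 a);
  delta : Wq2;
  delta_unit : delta \is a GRing.unit;
  delta_sigma : wsigma (witt_map delta) = - witt_map delta
}.

(** * Modules over subrings of the scalars *)

(* Scalars act on a vector space over [Q] through a map [f : S -> Q]. *)
Section Forms.
Variables (Q : fieldType) (V : lmodType Q).
Implicit Types (U L : set V).

Definition lin_span (S : nzRingType) (f : S -> Q) r (b : 'I_r -> V) : set V :=
  [set v | exists c : 'I_r -> S, v = \sum_i f (c i) *: b i].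

Definition is_submod (S : nzRingType) (f : S -> Q) L :=
  [/\ L 0, (forall v w, L v -> L w -> L (v + w)) &
      (forall a v, L v -> L (f a *: v))].

Definition is_basis (S : nzRingType) (f : S -> Q) U r (b : 'I_r -> V) :=
  U = lin_span f b /\
  forall c : 'I_r -> S, \sum_i f (c i) *: b i = 0 -> forall i, c i = 0.

(* [L] is the S-span of a T-basis of [U]. For [S] a discrete valuation ring with
   fraction field [T], these are the S-lattices in the T-vector space [U]. *)
Definition is_form (S T : nzRingType) (f : S -> Q) (g : T -> Q) U L :=
  exists r (b : 'I_r -> V), is_basis g U b /\ L = lin_span f b.

Definition base_change (S : nzRingType) (f : S -> Q) L : set V :=
  [set v | exists r (c : 'I_r -> S) (b : 'I_r -> V),
     (forall i, L (b i)) /\ v = \sum_i f (c i) *: b i].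

(* [B / A] has length [x] over [S], witnessed by a composition series. *)
Definition incl_length (S : nzRingType) (f : S -> Q) (x : nat) A B :=
  exists c : nat -> set V,
    [/\ c 0%N = A, c x = B, (forall i, (i <= x)%N -> is_submod f (c i)) &
      forall i, (i < x)%N ->
        [/\ c i `<=` c i.+1, c i <> c i.+1 &
          forall L, is_submod f L -> c i `<=` L -> L `<=` c i.+1 ->
            L = c i \/ L = c i.+1]].

Definition scale_set (a : Q) L : set V := [set a *: v | v in L].

(* Vectors of [U] pairing with [L] to values in the image of [f]. *)
Definition dual (S : nzRingType) (f : S -> Q) (g : V -> V -> Q) U L : set V :=
  [set v | U v /\ forall w, L w -> exists a, g v w = f a].

End Forms.

(** * The rational Dieudonne module *)

Definition ik p (D : base_data p) : Wk D -> Fk D := @tofrac (Wk D).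
Definition iq2 p (D : base_data p) : Wq2 D -> Fk D :=
  fun a => frac_map D (tofrac a).
Definition bpi p (D : base_data p) : Fk D := ik (witt_alg (Wk D) (unif D)).

(* [Nk] is the base change to [Fk] of the rational relative Dieudonne module [NQ]
   of a framing object over F_{q^2}; [NQ] sits in it as an [Fq2]-form. *)
Record isocrystal p (D : base_data p) (n : nat) := Isocrystal {
  Nk :> vectType (Fk D);
  Nk_dim : \dim {:Nk} = n.*2;
  NQ : set Nk;
  NQ_form : is_form (frac_map D) idfun [set: Nk] NQ;
  Fr : {additive Nk -> Nk};
  Ve : {additive Nk -> Nk};
  Fr_semilinear : forall a v, Fr (a *: v) = sigma D a *: Fr v;
  Ve_semilinear : forall a v, Ve (sigma D a *: v) = a *: Ve v;
  FrVe : forall v, Fr (Ve v) = bpi D *: v;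
  VeFr : forall v, Ve (Fr v) = bpi D *: v;
  Fr_NQ : forall v, NQ v -> NQ (Fr v);
  Ve_NQ : forall v, NQ v -> NQ (Ve v);
  (* isoclinic of slope 1/2 *)
  supersingular : exists (L : set Nk) (r : nat),
    [/\ is_form (@iq2 p D) (frac_map D) NQ L, (0 < r)%N &
        iter r.*2 Fr @` L = scale_set (bpi D ^+ r) L];
  act : bE D -> {linear Nk -> Nk};
  actD : forall a b v, act (a + b) v = act a v + act b v;
  actM : forall a b v, act (a * b) v = act a (act b v);
  act_alg : forall (a : OF D) v,
    act (int_val a)%:A v = ik (witt_alg (Wk D) a) *: v;
  act_Fr : forall a v, act a (Fr v) = Fr (act a v);
  act_Ve : forall a v, act a (Ve v) = Ve (act a v);
  act_NQ : forall a v, NQ v -> NQ (act a v);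
  pairing : Nk -> Nk -> Fk D;
  pairing_linear_l : forall a u v w,
    pairing (a *: u + v) w = a * pairing u w + pairing v w;
  pairing_linear_r : forall a u v w,
    pairing w (a *: u + v) = a * pairing w u + pairing w v;
  pairing_alt : forall v, pairing v v = 0;
  pairing_nondeg : forall v, (forall w, pairing v w = 0) -> v = 0;
  pairing_NQ : forall v w, NQ v -> NQ w -> exists a, pairing v w = frac_map D a;
  pairing_FrVe : forall v w, pairing (Fr v) w = sigma D (pairing v (Ve w));
  pairing_act : forall a v w, pairing (act a v) w = pairing v (act (star (bE D) a) w)
}.

Arguments NQ {p D n} _ _.
Arguments pairing {p D n} _ _ _.

Section Framing.
Variables (p : nat) (D : base_data p) (n m : nat) (h : nat -> nat).
Variable N : isocrystal D n.

(* The characteristic polynomial of [i(x)] on Lie = M / V M is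
   (T - x)(T - x^* )^(n-1); [e] lifts an F_{q^2}-basis of Lie. *)
Definition lie_charpoly (M : set N) :=
  forall x y : OE (bE D), int_val y = star (bE D) (int_val x) ->
  exists (e : 'I_n -> N) (P : 'M[Wq2 D]_n),
    [/\ (forall j, M (e j)),
        (forall v, M v -> exists c : 'I_n -> Wq2 D,
           (Ve N @` M) (v - \sum_l iq2 (c l) *: e l)),
        (forall c : 'I_n -> Wq2 D, (Ve N @` M) (\sum_l iq2 (c l) *: e l) ->
           forall l, witt_red (Wq2 D) (c l) = 0),
        (forall j, (Ve N @` M)
           (act N (int_val x) (e j) - \sum_l iq2 (P j l) *: e l)) &
        char_poly (map_mx (witt_red (Wq2 D)) P) =
          ('X - (redE (bE D) x)%:P) * ('X - (redE (bE D) y)%:P) ^+ n.-1].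

(* [M] is the Dieudonne module of the framing object X, and [al i] is the map
   induced by the isogeny alpha_{h_i, h_1}. As the latter is an isometry, the
   polarization lambda^[h_i] on [M] becomes the pairing of [N] on [al i @` M]. *)
Record framing := Framing {
  fM : set N;
  al : nat -> {linear N -> N};
  fM_stable : [/\ (forall v, fM v -> fM (Fr N v)),
                  (forall v, fM v -> fM (Ve N v)) &
                  (forall (a : OE (bE D)) v, fM v -> fM (act N (int_val a) v))];
  fM_lie : lie_charpoly fM;
  al1 : forall v, al 1 v = v;
  al_Fr : forall i v, (1 <= i <= m)%N -> al i (Fr N v) = Fr N (al i v);
  al_Ve : forall i v, (1 <= i <= m)%N -> al i (Ve N v) = Ve N (al i v);
  al_act : forall i a v, (1 <= i <= m)%N ->
    al i (act N a v) = act N a (al i v);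
  fM_lattice : forall i, (1 <= i <= m)%N ->
    is_form (@iq2 p D) (frac_map D) (NQ N) (al i @` fM);
  fM_polarized : forall i, (1 <= i <= m)%N ->
    let Md := dual (@iq2 p D) (pairing N) (NQ N) (al i @` fM) in
    [/\ al i @` fM `<=` Md,
        incl_length (@iq2 p D) (h i).*2 (al i @` fM) Md &
        scale_set (bpi D) Md `<=` al i @` fM];
  fM_isogeny : forall i j, (1 <= i)%N -> (i < j)%N -> (j <= m)%N ->
    [/\ al j @` fM `<=` al i @` fM,
        incl_length (@iq2 p D) (h j - h i) (al j @` fM) (al i @` fM) &
        scale_set (bpi D) (al i @` fM) `<=` al j @` fM]
}.

End Framing.

Arguments fM {p D n m h N} _ _.

(** * Hermitian space, vertex lattices and lattice chains *)

Section Strata.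
Variables (p : nat) (D : base_data p) (n m : nat) (h : nat -> nat).
Variable N : isocrystal D n.
Implicit Types (M A B Lam : set N).

Definition Nk0 : set N :=
  [set v | forall a, act N a v = frac_map D (phi0 D a) *: v].

(* The inverse of V, as F V = V F = pi. *)
Definition Vinv (v : N) : N := (bpi D)^-1 *: Fr N v.

Definition tau (v : N) : N := bpi D *: Vinv (Vinv v).

Definition C : set N := [set v | Nk0 v /\ tau v = v].

Definition herm (v w : N) : Fk D := iq2 (delta D) * pairing N v (Fr N w).

Definition is_lattice_C Lam := is_form (@iq2 p D) (frac_map D) C Lam.
Definition is_lattice_k M := is_form (@ik p D) idfun Nk0 M.

Definition dual_C Lam : set N := dual (@iq2 p D) herm C Lam.
Definition dual_k M : set N := dual (@ik p D) herm Nk0 M.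

Definition lattice_k Lam : set N := base_change (@ik p D) Lam.

Definition pis (i : nat) M : set N := scale_set (bpi D ^+ i) M.

Definition vertex (i : nat) Lam :=
  [/\ is_lattice_C Lam, pis i.+1 (dual_C Lam) `<=` Lam &
      Lam `<=` pis i (dual_C Lam)].

Definition vertex_ge (i x : nat) Lam :=
  vertex i Lam /\
  exists t, incl_length (@iq2 p D) t (pis i.+1 (dual_C Lam)) Lam /\ (x <= t)%N.

Definition Tsum (s : nat) M : set N :=
  [set v | exists y : 'I_s -> N,
     (forall j, M (y j)) /\ v = \sum_(j < s) iter j tau (y j)].

(* The lattice of [C] whose base change to W(k) is the stable value of
   [Tsum s M]. *)
Definition bt_lattice M : set N :=
  xget set0 [set Lam | is_lattice_C Lam /\
    exists s0, forall s, (s0 <= s)%N -> lattice_k Lam = Tsum s M].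

(* The k-points of the moduli space, as lattice chains through relative
   Dieudonne theory: A_m, ..., A_1, B_1, ..., B_m. The values at indices outside
   1, ..., m are irrelevant. *)
Record is_point (A B : nat -> set N) : Prop := {
  point_lattice : forall i, (1 <= i <= m)%N ->
    is_lattice_k (A i) /\ is_lattice_k (B i);
  point_A : forall i, (1 <= i < m)%N -> A i.+1 `<=` A i;
  point_AB : A 1%N `<=` B 1%N;
  point_B : forall i, (1 <= i < m)%N -> B i `<=` B i.+1;
  point_dualA : forall i, (1 <= i <= m)%N ->
    [/\ pis 1 (dual_k (A i)) `<=` B i,
        incl_length (@ik p D) 1 (pis 1 (dual_k (A i))) (B i) &
        B i `<=` dual_k (A i)];
  point_dualB : forall i, (1 <= i <= m)%N ->
    [/\ pis 1 (dual_k (B i)) `<=` A i,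
        incl_length (@ik p D) 1 (pis 1 (dual_k (B i))) (A i) &
        A i `<=` dual_k (B i)];
  point_h : forall i, (1 <= i <= m)%N ->
    [/\ pis 1 (B i) `<=` A i, A i `<=` B i &
        incl_length (@ik p D) (h i) (A i) (B i)]
}.

Definition bt_type (A B : nat -> set N) : set nat :=
  [set i | [\/ i = 0%N /\ vertex 1 (bt_lattice (A 1%N)),
               i = m /\ vertex 0 (bt_lattice (B m)) |
               (1 <= i < m)%N /\
               bt_lattice (B i) `<=` pis 1 (dual_C (bt_lattice (A i.+1)))]].

(* The values [L0 i] and [L1 i] are relevant only for i in I minus 0 and in I
   minus m, respectively. *)
Record bt_data := BTData {
  supp : set nat;
  L0 : nat -> set N;
  L1 : nat -> set N
}.

Record bt_index (T : bt_data) : Prop := {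
  bti_sub : forall i, supp T i -> (i <= m)%N;
  bti_nonempty : supp T !=set0;
  bti_0 : h 1 = 0%N -> ~ supp T 0%N;
  bti_m : h m = n -> ~ supp T m;
  bti_L0 : forall i, supp T i -> i <> 0%N -> vertex_ge 0 (h i).+1 (L0 T i);
  bti_L1 : forall j, supp T j -> j <> m ->
    vertex_ge 1 (n - h j.+1).+1 (L1 T j);
  bti_same : forall i, supp T i -> i <> 0%N -> i <> m ->
    L0 T i `<=` pis 1 (dual_C (L1 T i));
  (* for consecutive elements i < j of I *)
  bti_next : forall i j, supp T i -> supp T j -> (i < j)%N ->
    (forall l, (i < l < j)%N -> ~ supp T l) ->
    pis 1 (dual_C (L1 T i)) `<=` L0 T j
}.

Definition bt_eq (T' T : bt_data) :=
  [/\ supp T' = supp T,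
      (forall i, supp T i -> i <> 0%N -> L0 T' i = L0 T i) &
      (forall j, supp T j -> j <> m -> L1 T' j = L1 T j)].

Definition bt_le (T' T : bt_data) :=
  [/\ supp T `<=` supp T',
      (forall i, supp T i -> i <> 0%N -> L0 T' i `<=` L0 T i) &
      (forall j, supp T j -> j <> m -> L1 T' j `<=` L1 T j)].

Definition bt_lt (T' T : bt_data) := bt_le T' T /\ ~ bt_eq T' T.

(* For a point [(A, B)] of the moduli space over k: [stratum] is membership in
   the k-points of the closed subscheme attached to [T], by their description in
   terms of lattices, and [open_stratum] membership in the complement of the
   strictly smaller closed strata. *)
Definition stratum (T : bt_data) (A B : nat -> set N) :=
  (forall i, supp T i -> i <> 0%N -> B i `<=` lattice_k (L0 T i)) /\
  (forall j, supp T j -> j <> m -> A j.+1 `<=` lattice_k (L1 T j)).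

Definition open_stratum (T : bt_data) (A B : nat -> set N) :=
  stratum T A B /\
  ~ exists T', [/\ bt_index T', bt_lt T' T & stratum T' A B].

End Strata.

Arguments Nk0 {p D n} _ _.
Arguments C {p D n} _ _.

(* Main.v *)
(** For a point of the moduli space, the lattices generated by the [tau]-orbits of
    the [A i] and [B i] are the smallest lattices of [C] whose base change contains
    them. They are defined over [C] by descent: inside [L_k], for [L] a lattice of
    [C], a proper [tau]-stable lattice reduces into a hyperplane of [L_k / pi L_k]
    rational over F_{q^2}, hence lies in the base change of a smaller lattice. That
    some lattice of [C] spans [Nk0] at all is forced by either side of the
    equivalence.

    By minimality, the Bruhat-Tits type of a point together with its lattices
    [bt_lattice (B i)] and [bt_lattice (A i.+1)] lies below every index whose closed
    stratum contains the point. Duality and a count of lengths show that it is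
    itself a Bruhat-Tits index as soon as it is non-empty; this is automatic here,
    since the type contains the support of the given index. The open stratum
    containing the point is therefore the one attached to its type. *)

Require Import Defs.
From mathcomp Require Import all_boot all_order all_algebra all_field.
From mathcomp Require Import all_classical.
From HB Require Import structures.

Set Implicit Arguments.
Unset Strict Implicit.
Unset Printing Implicit Defensive.

Import GRing.Theory.
Local Open Scope classical_set_scope.
Local Open Scope ring_scope.

(** * Discrete valuation rings *)

(** Lengths are treated through strict chains of submodules instead of quotients: [chain_in] bounds
    a length from below, [length_le] from above, and a composition series gives both bounds. To
    bound the type of a vertex lattice from below, it is enough that upper bounds survive base
    change: a composition series over W(F_{q^2}) with [y] steps limits every strict chain of
    W(k)-modules to [y] steps, and the point supplies long chains. These chains explain the
    thresholds in the definition of an index: [pi B^dual < A <= B] has 1 + h steps, and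
    [pi^2 A^dual < pi B <= A] has at least 1 + (n - h). The second count needs [B / pi B] to have
    length n, that is, [Nk0] to have dimension n. This follows from the total dimension 2n, because
    Frobenius and Verschiebung interchange the two eigenspaces of the quadratic action. *)

Lemma fraction_div (W : idomainType) (x : {fraction W}) :
  exists a b : W, b != 0 /\ x = tofrac a / tofrac b.
Proof.
elim/quotW: x => r; exists \n_r, \d_r; split; first exact: denom_ratioP.
unlock tofrac; rewrite -[X in _ / X]/(\pi_({fraction W})%qT _).
rewrite -[X in _ = _ * X]FracField.pi_inv -[RHS]FracField.pi_mul.
rewrite /FracField.mulf /FracField.invf /=.
rewrite !numden_Ratio ?oner_neq0 ?denom_ratioP //.
by rewrite mulr1 mul1r Ratio_numden.
Qed.

(** Linearity of the action and of [phi0] is given on [OF] only; denominators are cleared with this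
    lemma. If [D] clears the coefficients of a monic equation of degree [n] for [x], then [D x] is a
    root of the monic polynomial with coefficients [D^(n-i) q_i]. *)
Lemma integral_multiple (A : idomainType) (K : fieldExtType {fraction A}) (x : K) :
  exists d : A, d != 0 /\ integralOver (in_alg K \o @tofrac A) ((tofrac d)%:A * x).
Proof.
have [q mq qx] : exists2 q : {poly {fraction A}}, q \is monic & root (map_poly (in_alg K) q) x.
  have /polyOver1P [q qE] := minPolyOver 1 x.
  exists q; last by rewrite -qE root_minPoly.
  by rewrite -(map_monic (in_alg K)) -qE monic_minPoly.
pose n := (size q).-1.
have sq : size q = n.+1 by rewrite prednK // size_poly_gt0 monic_neq0.
have ex i : exists d : A, d != 0 /\ exists a, tofrac d * q`_i = tofrac a.
  have [a [b [b0 ->]]] := fraction_div q`_i; exists b; split=> //; exists a.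
  by rewrite mulrC divfK // tofrac_eq0.
have [d dP] := choice ex.
pose D := \prod_(i < n) d i.
have D0 : D != 0 by apply/prodf_neq0 => i _; have [] := dP i.
have DP (i : 'I_n) : exists a, tofrac D * q`_i = tofrac a.
  have [_ [a aE]] := dP i; exists ((\prod_(j < n | j != i) d j) * a).
  by rewrite tofracM -aE /D (bigD1 i) //= tofracM -mulrA mulrCA.
exists D; split=> //.
set e : K := (tofrac D)%:A.
pose r := \poly_(i < n.+1) (e ^+ (n - i) * (q`_i)%:A).
have rn : r`_n = 1.
  rewrite coef_poly leqnn subnn expr0 mul1r.
  by move: mq; rewrite monicE lead_coefE -/n => /eqP->; rewrite scale1r.
have sr : size r = n.+1.
  apply/eqP; rewrite eqn_leq size_poly /= ltnNge; apply/negP => /leq_sizeP /(_ n (leqnn _)).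
  by rewrite rn => /eqP; rewrite oner_eq0.
have mr : r \is monic by rewrite monicE lead_coefE sr rn.
apply: (integral_root_monic mr).
- apply/rootP; rewrite horner_poly.
  move/rootP: qx; rewrite horner_coef size_map_poly sq => qx.
  rewrite -[RHS](mulr0 (e ^+ n)) -[in RHS]qx mulr_sumr; apply: eq_bigr => i _.
  rewrite coef_map /= exprMn mulrA -[_ * e ^+ i]mulrAC -exprD subnK 1?mulrA //.
  by rewrite -ltnS.
apply/integral_poly => i; rewrite coef_poly; case: ltnP => [|_]; last exact: integral0.
rewrite ltnS leq_eqVlt => /orP[/eqP->|ilt].
  rewrite subnn expr0 mul1r.
  move: mq; rewrite monicE lead_coefE -/n => /eqP->; rewrite scale1r; exact: integral1.
have [a aE] := DP (Ordinal ilt).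
have -> : e ^+ (n - i) * (q`_i)%:A = (in_alg K \o @tofrac A) (D ^+ (n - i).-1 * a).
  rewrite /= tofracM tofracXn -aE /= mulrA -exprSr prednK ?subn_gt0 //.
  by rewrite -[RHS]/(in_alg K _) rmorphM rmorphXn.
exact: integral_id.
Qed.

Section StrictRing.
Variables (W : idomainType) (t : W) (R : fieldType) (red : {rmorphism W -> R}).
Hypothesis st : strict_ring t red.

Lemma strict_red_unif : red t = 0.
Proof. by apply/(strict_ker st); exists 1; rewrite mulr1. Qed.

Lemma strict_unif_neq0 : t != 0.
Proof.
apply/eqP=> t0; have := strict_torsion st (x := 1).
by rewrite t0 mul0r => /(_ erefl) /eqP; rewrite oner_eq0.
Qed.

(** Lift the inverse of the residue to [b0]. Then [a b0 = 1 - z] with [z] divisible by [t], and [b0]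
    times the limit of the geometric series in [z] inverts [a]. *)
Lemma strict_unit a : red a != 0 -> exists b, a * b = 1.
Proof.
move=> ra; have [b0 rb0] := strict_surj st (red a)^-1.
have [y hy] : exists y, 1 - a * b0 = t * y.
  by apply/(strict_ker st); rewrite rmorphB rmorph1 rmorphM rb0 divff ?subrr.
pose z := t * y.
have [x hx] : exists x, forall j, exists w, x - \sum_(i < j) z ^+ i = t ^+ j * w.
  apply: (strict_complete st) => j; exists (y ^+ j).
  by rewrite big_ord_recr addrAC subrr add0r exprMn.
exists (b0 * x); apply/eqP; rewrite mulrA -subr_eq0; apply/eqP.
apply: (strict_separated st) => j; have [w hw] := hx j.
have -> : a * b0 = 1 - z by rewrite /z -hy opprB addrC subrK.
have -> : x = t ^+ j * w + \sum_(i < j) z ^+ i by rewrite -hw subrK.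
have geo : (1 - z) * (\sum_(i < j) z ^+ i) = 1 - z ^+ j.
  by rewrite -[RHS]opprB subrX1 -[in RHS]mulNr opprB.
exists ((1 - z) * w - y ^+ j).
by rewrite mulrDr geo addrA addrAC addrK mulrBr -exprMn mulrCA.
Qed.

Lemma strict_valuation x : x != 0 ->
  exists N u, x = t ^+ N * u /\ red u != 0.
Proof.
move=> x0.
(* The least power of [t] that does not divide [x] will have exponent [N + 1]; separatedness
   provides one. *)
have ex : exists j, ~~ `[< exists y, x = t ^+ j * y >].
  apply: contrapT => H; move/eqP: x0; apply.
  apply: (strict_separated st) => j; apply: contrapT => hj; apply: H.
  by exists j; apply/negP => /asboolP.
case: (ex_minnP ex) => [[|N]] /negP hN min.
  by case: hN; apply/asboolP; exists x; rewrite expr0 mul1r.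
have : `[< exists y, x = t ^+ N * y >].
  by apply: contrapT => /negP /min; rewrite ltnn.
case/asboolP=> u hu; exists N, u; split=> //.
apply/eqP => /(strict_ker st) [y hy]; apply: hN; apply/asboolP.
by exists y; rewrite hu hy exprS mulrA [t * _]mulrC.
Qed.

Lemma strict_frac (x : {fraction W}) :
  exists N w, tofrac t ^+ N * x = tofrac w.
Proof.
have [a [b [b0 ->]]] := fraction_div x.
have [N [u [-> ru]]] := strict_valuation b0.
have [v uv] := strict_unit ru.
exists N, (a * v).
have tN : tofrac t ^+ N != 0 :> {fraction W}.
  by rewrite expf_neq0 ?tofrac_eq0 ?strict_unif_neq0.
have u0 : tofrac u != 0 :> {fraction W}.
  by rewrite tofrac_eq0; apply: contra_neq ru => ->; rewrite rmorph0.
apply: (mulIf u0); rewrite tofracM tofracXn mulrAC mulrCA divff ?mulf_neq0 //.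
by rewrite mulr1 -tofracM -mulrA [v * u]mulrC uv mulr1.
Qed.

End StrictRing.

(** * Chains of submodules *)

Section Chains.
Variables (Q : fieldType) (V : lmodType Q) (S : idomainType).
Variable f : {rmorphism S -> Q}.
Implicit Types (A B L : set V) (c d : nat -> set V).

Lemma submodN L v : is_submod f L -> L v -> L (- v).
Proof. by case=> _ _ /(_ (-1) v) H /H; rewrite rmorphN1 scaleN1r. Qed.

Lemma submodB L v w : is_submod f L -> L v -> L w -> L (v - w).
Proof. by move=> sL Lv /(submodN sL) Lw; have [_ D _] := sL; exact: D. Qed.

Lemma submod_sum L I (r : seq I) (P : pred I) (F : I -> V) : is_submod f L ->
  (forall i, P i -> L (F i)) -> L (\sum_(i <- r | P i) F i).
Proof. by case=> L0 LD _ LF; apply: big_ind. Qed.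

Lemma submod_setI A B : is_submod f A -> is_submod f B -> is_submod f (A `&` B).
Proof.
move=> [A0 AD AZ] [B0 BD BZ]; split=> // [v w [? ?] [? ?]|a v [? ?]].
  by split; [exact: AD|exact: BD].
by split; [exact: AZ|exact: BZ].
Qed.

Definition add_set A B : set V := [set v | exists a b, [/\ A a, B b & v = a + b]].

Lemma submod_add A B : is_submod f A -> is_submod f B -> is_submod f (add_set A B).
Proof.
move=> [A0 AD AZ] [B0 BD BZ]; split.
- by exists 0, 0; rewrite addr0.
- move=> _ _ [a [b [Aa Bb ->]]] [a' [b' [Aa' Bb' ->]]].
  by exists (a + a'), (b + b'); split; [exact: AD|exact: BD|rewrite addrACA].
- move=> s _ [a [b [Aa Bb ->]]]; exists (f s *: a), (f s *: b).
  by split; [exact: AZ|exact: BZ|rewrite scalerDr].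
Qed.

Definition adjoin A e : set V := [set v | exists w s, A w /\ v = w + f s *: e].

Lemma submod_adjoin A e : is_submod f A -> is_submod f (adjoin A e).
Proof.
move=> [A0 AD AZ]; split.
- by exists 0, 0; rewrite rmorph0 scale0r addr0.
- move=> _ _ [w [s [Aw ->]]] [w' [s' [Aw' ->]]]; exists (w + w'), (s + s').
  by split; [exact: AD|rewrite rmorphD scalerDl addrACA].
- move=> a _ [w [s [Aw ->]]]; exists (f a *: w), (a * s).
  by split; [exact: AZ|rewrite scalerDr scalerA rmorphM].
Qed.

Lemma sub_adjoin A e : A `<=` adjoin A e.
Proof. by move=> w Aw; exists w, 0; rewrite rmorph0 scale0r addr0. Qed.

Lemma mem_adjoin A e : is_submod f A -> adjoin A e e.
Proof. by case=> A0 _ _; exists 0, 1; rewrite rmorph1 scale1r add0r. Qed.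

Lemma adjoin_sub A e L : is_submod f L -> A `<=` L -> L e -> adjoin A e `<=` L.
Proof. by case=> _ LD LZ AL Le _ [w [s [/AL Lw ->]]]; apply/LD/LZ. Qed.

Definition chain_in c x A B :=
  (forall i, (i <= x)%N -> [/\ is_submod f (c i), A `<=` c i & c i `<=` B]) /\
  (forall i, (i < x)%N -> c i `<=` c i.+1 /\ c i <> c i.+1).

(** An upper bound for the length of [B / A] in terms of chains, so that shrinking the interval from
    [A] to [B] visibly preserves it. *)
Definition length_le x A B := forall c y, chain_in c y A B -> (y <= x)%N.

Lemma length_le_sub x A B A' B' : A `<=` A' -> B' `<=` B ->
  length_le x A B -> length_le x A' B'.
Proof.
move=> AA BB H c y [cy cS]; apply: (H c y); split=> // i /cy [? ? ?].
by split=> //; [exact: subset_trans AA _|exact: subset_trans BB].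
Qed.

Lemma chain_rcons c x A B L : chain_in c x A B -> is_submod f L ->
  c x `<=` L -> c x <> L -> L `<=` B ->
  chain_in (fun i => if (i <= x)%N then c i else L) x.+1 A B.
Proof.
move=> [cx cS] sL cL nL LB; split=> i ix.
  case: ifP => [/cx//|_]; split=> //.
  by have [_ Ac _] := cx _ (leqnn x); exact: subset_trans Ac cL.
move: ix; rewrite ltnS => ix; rewrite ix; case: ifP => [/cS//|/negbT].
by rewrite -leqNgt => xi; have -> : i = x by apply/eqP; rewrite eqn_leq ix.
Qed.

(** Discarding the repetitions of a weak chain leaves a strict chain whose number of steps is the
    sum. The induction also keeps track of its last term, onto which the next one is put. *)
Lemma weak_chain_count c x z A B :
  (forall i, (i <= z)%N -> [/\ is_submod f (c i), A `<=` c i & c i `<=` B]) ->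
  (forall i, (i < z)%N -> c i `<=` c i.+1) ->
  length_le x A B -> (\sum_(i < z) `[< c i <> c i.+1 >] <= x)%N.
Proof.
move=> cz cS len.
suff [d [Hd _]] : exists d, chain_in d (\sum_(i < z) `[< c i <> c i.+1 >])%N A B /\
    d (\sum_(i < z) `[< c i <> c i.+1 >])%N = c z by exact: len Hd.
elim: z cz cS => [|z IH] cz cS.
  by rewrite big_ord0; exists c.
have [d [Hd dz]] : exists d, chain_in d (\sum_(i < z) `[< c i <> c i.+1 >])%N A B /\
    d (\sum_(i < z) `[< c i <> c i.+1 >])%N = c z.
  by apply: IH => i iz; [apply: cz|apply: cS]; exact: leqW.
rewrite big_ord_recr /=; case: asboolP => [ne|/contrapT eq] /=; last first.
  by rewrite addn0; exists d; rewrite dz.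
rewrite addn1; have [? ? ?] := cz _ (leqnn z.+1).
have le := cS _ (leqnn z.+1).
eexists; split; first by apply: (chain_rcons Hd (L := c z.+1)); rewrite ?dz.
by rewrite /= ltnn.
Qed.

(* Modular law: [L `<=` L'] are equal as soon as they have the same intersection
   and the same sum with [B]. *)
Lemma length_le_trans x y A B C' : is_submod f B -> is_submod f C' -> A `<=` B -> B `<=` C' ->
  length_le x A B -> length_le y B C' -> length_le (x + y) A C'.
Proof.
move=> sB sC AB BC lx ly c z [cz cS].
have [B0 BD BZ] := sB.
have mono i : (i < z)%N -> c i `<=` c i.+1 by move=> /cS[].
have h1 : (\sum_(i < z) `[< c i `&` B <> c i.+1 `&` B >] <= x)%N.
  apply: (weak_chain_count (c := fun i => c i `&` B)) lx => i iz; last by move=> v [/(mono _ iz) ? ?].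
  have [? ? ?] := cz i iz; split=> [||v []//]; first exact: submod_setI.
  by move=> v Av; split; auto.
have h2 : (\sum_(i < z) `[< add_set (c i) B <> add_set (c i.+1) B >] <= y)%N.
  apply: (weak_chain_count (c := fun i => add_set (c i) B)) ly => i iz; last first.
    by move=> _ [a [b [/(mono _ iz) ? ? ->]]]; exists a, b.
  have [si ? ?] := cz i iz; split; first exact: submod_add.
    by move=> v Bv; exists 0, v; rewrite add0r; split=> //; case: si.
  have [_ _ cC] := cz i iz; have [_ CD _] := sC.
  by move=> _ [a [b [/cC Ca /BC Cb ->]]]; exact: CD.
apply: leq_trans (leq_add h1 h2); rewrite -big_split /=.
rewrite -[X in (X <= _)%N]card_ord -sum1_card; apply: leq_sum => i _.
have [le ne] := cS i (ltn_ord i).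
case: asboolP => [//|/contrapT eI]; case: asboolP => [//|/contrapT eS].
case: ne; apply/seteqP; split=> // v cv.
have [si _ _] := cz i (ltnW (ltn_ord i)); have [si' _ _] := cz i.+1 (ltn_ord i).
have : add_set (c i.+1) B v by exists v, 0; rewrite addr0.
rewrite -eS => -[a [b [ca Bb vE]]].
have : (c i.+1 `&` B) b.
  split=> //; have -> : b = v - a by rewrite vE addrAC subrr add0r.
  by apply: (submodB si') => //; exact: le.
by rewrite -eI => -[cb _]; rewrite vE; have [_ D _] := si; exact: D.
Qed.

End Chains.

(** * Concatenation of chains, and rescaling of submodules *)

Section ChainConcatenation.
Variables (Q : fieldType) (V : lmodType Q) (S : idomainType).
Variable f : {rmorphism S -> Q}.
Implicit Types (A B : set V).

Lemma chain_cat c d x y A B B' C' : A `<=` B' -> B `<=` C' -> B `<=` B' ->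
  chain_in f c x A B -> chain_in f d y B' C' ->
  exists e, chain_in f e (x + y) A C'.
Proof.
move=> AB' BC BB [cx cS] [dy dS].
(* The term [d 0] is skipped: it contains [c x] and is strictly smaller than [d 1], so the step from
   [c x] to [d 1] is strict. *)
exists (fun i => if (i <= x)%N then c i else d (i - x)%N); split=> i ixy.
  case: leqP => ix.
    by have [? ? cB] := cx i ix; split=> //; exact: subset_trans cB BC.
  have [|? Bd ?] := dy (i - x)%N; first by rewrite leq_subLR.
  by split=> //; exact: subset_trans AB' Bd.
case: (leqP i x) => [ix|xi]; case: (leqP i.+1 x) => [ix'|xi'].
- exact: cS.
- have {ix xi'} xE : i = x by apply/eqP; rewrite eqn_leq ix -ltnS.
  subst i; rewrite subSnn; have y0 : (0 < y)%N by rewrite -(ltn_add2l x) addn0.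
  have [_ _ cB] := cx x (leqnn x); have [_ Bd _] := dy 0%N (leq0n y).
  have [d01 nd] := dS 0%N y0.
  have cd : c x `<=` d 0%N by apply: subset_trans cB (subset_trans BB Bd).
  split; first exact: subset_trans cd d01.
  by move=> E; apply: nd; apply/seteqP; split=> //; rewrite -E.
- by move: (leq_trans xi (ltnW ix')); rewrite ltnn.
- rewrite subSn; last exact: ltnW.
  by apply: dS; rewrite ltn_subLR // ltnW.
Qed.

Lemma chain_one A B : is_submod f A -> is_submod f B -> A `<=` B -> A <> B ->
  exists c, chain_in f c 1 A B.
Proof.
move=> sA sB AB ne; exists (fun i => if i is 0%N then A else B).
have rr (L : set V) : L `<=` L by [].
by split=> [] [|[|i]].
Qed.

Lemma incl_length1_neq A B : incl_length f 1 A B -> A <> B.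
Proof. by case=> c [<- <- _ /(_ 0%N isT) []]. Qed.

Lemma incl_length_chain x A B : incl_length f x A B -> exists c, chain_in f c x A B.
Proof.
case=> c [<- <- sub simple]; exists c.
have mono i j : (i <= j)%N -> (j <= x)%N -> c i `<=` c j.
  elim: j => [|j IH]; first by rewrite leqn0 => /eqP-> _ v.
  rewrite leq_eqVlt => /orP[/eqP-> _ v //|ij jx] v /(IH ij (ltnW jx)).
  by have [le _ _] := simple j jx; exact: le.
split=> i ix; first by split; [exact: sub|exact: mono|exact: mono].
by have [] := simple i ix.
Qed.

Lemma submod_scale_set e A : is_submod f A -> is_submod f (scale_set e A).
Proof.
move=> [A0 AD AZ]; split.
- by exists 0; rewrite ?scaler0.
- by move=> _ _ [v Av <-] [w Aw <-]; exists (v + w); rewrite ?scalerDr //; exact: AD.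
- move=> a _ [v Av <-]; exists (f a *: v); first exact: AZ.
  by rewrite !scalerA mulrC.
Qed.

Lemma scale_set_sub e A B : A `<=` B -> scale_set e A `<=` scale_set e B.
Proof. by move=> AB _ [v /AB Bv <-]; exists v. Qed.

Lemma scale_set_inj e A B : e != 0 -> scale_set e A = scale_set e B -> A = B.
Proof.
move=> e0 E; apply/seteqP; split=> v Lv.
  have : scale_set e B (e *: v) by rewrite -E; exists v.
  by case=> w Bw /(scalerI e0) <-.
have : scale_set e A (e *: v) by rewrite E; exists v.
by case=> w Aw /(scalerI e0) <-.
Qed.

End ChainConcatenation.

(** * Composition series and lengths over a complete discrete valuation ring *)

Section Lengths.
Variables (Q : fieldType) (V : lmodType Q) (S : idomainType).
Variables (f : {rmorphism S -> Q}) (t : S).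
Variables (R : fieldType) (red : {rmorphism S -> R}).
Hypothesis st : strict_ring t red.
Implicit Types (A B L : set V).

Lemma length_le_refl A : length_le f 0 A A.
Proof.
move=> c [//|y] [cy cS]; have [_ []] := cS 0%N isT.
have [_ Ac cA] := cy 0%N isT; have [_ Ac' cA'] := cy 1%N isT.
by apply/seteqP; split=> v ?; auto.
Qed.

Lemma length_le_simple A B :
  (forall L, is_submod f L -> A `<=` L -> L `<=` B -> L = A \/ L = B) ->
  length_le f 1 A B.
Proof.
move=> simple c [|[|y]] // [cy cS].
have [_ Ac0 _] := cy 0%N isT; have [s1 Ac1 c1B] := cy 1%N isT.
have [_ _ c2B] := cy 2%N isT.
have [le0 ne0] := cS 0%N isT; have [le1 ne1] := cS 1%N isT.
have [c1A|c1E] := simple _ s1 Ac1 c1B.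
  by case: ne0; apply/seteqP; split=> // v; rewrite c1A => /Ac0.
by case: ne1; apply/seteqP; split=> // v /c2B; rewrite c1E.
Qed.

(** The upper-bound half of Jordan-Hölder: a simple step allows chains with at most one step, and
    bounds add up along the series. *)
Lemma incl_length_le x A B : incl_length f x A B -> length_le f x A B.
Proof.
case=> c [<- <- sub simple].
have mono i : (i <= x)%N -> c 0%N `<=` c i.
  elim: i => [_ v //|i IH ix v /(IH (ltnW ix))].
  by have [le _ _] := simple i ix; exact: le.
suff: forall i, (i <= x)%N -> length_le f i (c 0%N) (c i) by apply.
elim=> [_|i IH ix]; first exact: length_le_refl.
have [le _ simp] := simple i ix.
rewrite -[X in length_le _ X]addn1; apply: length_le_trans (IH (ltnW ix)) _.
- exact: sub (ltnW ix).
- exact: sub ix.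
- exact: mono (ltnW ix).
- exact: le.
- exact: length_le_simple.
Qed.

(** [S] is local with maximal ideal generated by [t]. An element [w + s e] of [L] with [s] a unit
    puts [e] into [L]; if [t] divides [s], the element lies in [A]. *)
Lemma adjoin_simple A e L : is_submod f A -> A (f t *: e) ->
  is_submod f L -> A `<=` L -> L `<=` adjoin f A e -> L = A \/ L = adjoin f A e.
Proof.
move=> sA Ate sL AL LA.
have [Le|nLe] := pselect (L e).
  by right; apply/seteqP; split=> //; exact: adjoin_sub.
left; apply/seteqP; split=> // v Lv; have [w [s [Aw vE]]] := LA v Lv.
have [_ AD AZ] := sA; have [_ _ LZ] := sL.
have [/(strict_ker st) [y sE]|rs] := eqVneq (red s) 0.
  rewrite vE; apply: AD => //.
  by rewrite sE mulrC rmorphM -scalerA; exact: AZ.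
have [s' ss'] := strict_unit st rs; case: nLe.
have -> : e = f s' *: (v - w).
  by rewrite vE addrAC subrr add0r scalerA -rmorphM mulrC ss' rmorph1 scale1r.
by apply/LZ/(submodB sL) => //; exact: AL.
Qed.

(** As [t] kills [B / A], adjoining any vector of [B] outside [A] is a simple step, and the bound
    [x] makes the process stop. *)
Lemma incl_length_exists x A B : is_submod f A -> is_submod f B -> A `<=` B ->
  (forall v, B v -> A (f t *: v)) -> length_le f x A B ->
  exists y, incl_length f y A B.
Proof.
elim: x A => [|x IH] A sA sB AB BA len.
  suff -> : A = B by exists 0%N, (fun=> B); split.
  apply: contrapT => ne; suff /len : chain_in f (fun i => if i is 0%N then A else B) 1 A B by [].
  have rr (L : set V) : L `<=` L by [].
  by split=> [] [|[|i]].
have [->|ne] := pselect (A = B).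
  by exists 0%N, (fun=> B); split.
have [e [Be nAe]] : exists e, B e /\ ~ A e.
  apply: contrapT => H; apply: ne; apply/seteqP; split=> // v Bv.
  by apply: contrapT => nAv; apply: H; exists v.
have sA' := submod_adjoin e sA.
have A'B : adjoin f A e `<=` B by exact: adjoin_sub.
have AA' := @sub_adjoin _ _ _ f A e.
have neA : A <> adjoin f A e by move=> E; apply: nAe; rewrite E; exact: mem_adjoin.
have [|c y [cy cS]|y [c [c0 cy cS simple]]] := IH (adjoin f A e) sA' sB A'B.
- by move=> v /BA; exact: AA'.
- move: (len (fun i => if i is j.+1 then c j else A) y.+1); apply; split.
    case=> [|i] iy; first by split.
    by have [? ? ?] := cy i iy; split=> //; exact: subset_trans AA' _.
  case=> [_|i iy]; last exact: cS.
  have [_ A'c _] := cy 0%N isT; split; first exact: subset_trans AA' A'c.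
  by move=> E; apply: nAe; rewrite E; apply/A'c/mem_adjoin.
exists y.+1, (fun i => if i is j.+1 then c j else A); split=> //.
  by case=> [//|i]; exact: cS.
case=> [_|i]; last exact: simple.
rewrite c0; split=> // L sL AL LA; apply: adjoin_simple => //; exact: BA.
Qed.

Lemma submod_lin_span r (b : 'I_r -> V) : is_submod f (lin_span f b).
Proof.
split.
- by exists (fun=> 0); rewrite big1 // => i _; rewrite rmorph0 scale0r.
- move=> _ _ [c ->] [d ->]; exists (fun i => c i + d i); rewrite -big_split.
  by apply: eq_bigr => i _; rewrite rmorphD scalerDl.
- move=> a _ [c ->]; exists (fun i => a * c i); rewrite scaler_sumr.
  by apply: eq_bigr => i _; rewrite rmorphM scalerA.
Qed.

Lemma mem_lin_span r (b : 'I_r -> V) i : lin_span f b (b i).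
Proof.
exists (fun j => (j == i)%:R); rewrite (bigD1 i) //= eqxx rmorph1 scale1r big1 ?addr0//.
by move=> j /negPf->; rewrite rmorph0 scale0r.
Qed.

Lemma lin_span_sub r (b : 'I_r -> V) L : is_submod f L -> (forall i, L (b i)) ->
  lin_span f b `<=` L.
Proof.
by move=> sL Lb _ [c ->]; apply: (submod_sum _ sL) => i _; have [_ _ LZ] := sL; exact: LZ.
Qed.

(** Interpolates between [t] times the span ([k = 0]) and the span ([k = r]), releasing one
    coordinate at a time. *)
Definition flag r (b : 'I_r -> V) (k : nat) : set V :=
  [set v | exists c : 'I_r -> S, v = \sum_i f (c i) *: b i /\
     forall i : 'I_r, (k <= i)%N -> exists d, c i = t * d].

Lemma submod_flag r (b : 'I_r -> V) k : is_submod f (flag b k).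
Proof.
split.
- exists (fun=> 0); split; last by move=> *; exists 0; rewrite mulr0.
  by rewrite big1 // => i _; rewrite rmorph0 scale0r.
- move=> _ _ [c [-> Hc]] [d [-> Hd]]; exists (fun i => c i + d i); split.
    by rewrite -big_split; apply: eq_bigr => i _; rewrite rmorphD scalerDl.
  move=> i ki; have [y ->] := Hc i ki; have [z ->] := Hd i ki.
  by exists (y + z); rewrite mulrDr.
- move=> a _ [c [-> Hc]]; exists (fun i => a * c i); split.
    by rewrite scaler_sumr; apply: eq_bigr => i _; rewrite rmorphM scalerA.
  by move=> i ki; have [y ->] := Hc i ki; exists (a * y); rewrite mulrCA.
Qed.

Lemma flag0 r (b : 'I_r -> V) : flag b 0 = lin_span f (fun i => f t *: b i).
Proof.
apply/seteqP; split=> v.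
  case=> c [-> Hc]; have [d dE] := choice (fun i => Hc i (leq0n i)); exists d.
  by apply: eq_bigr => i _; rewrite dE mulrC rmorphM scalerA.
case=> d ->; exists (fun i => t * d i); split; last by move=> i _; exists (d i).
by apply: eq_bigr => i _; rewrite mulrC rmorphM scalerA.
Qed.

Lemma flag_full r (b : 'I_r -> V) : flag b r = lin_span f b.
Proof.
apply/seteqP; split=> v [c]; first by case=> -> _; exists c.
by move=> ->; exists c; split=> // i; rewrite leqNgt ltn_ord.
Qed.

Lemma flag_step r (b : 'I_r -> V) (k : 'I_r) :
  flag b k.+1 `<=` adjoin f (flag b k) (b k).
Proof.
move=> _ [c [-> Hc]].
exists (\sum_i f (if i == k then 0 else c i) *: b i), (c k); split.
  exists (fun i => if i == k then 0 else c i); split=> // i ki.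
  case: eqVneq => [_|ne]; first by exists 0; rewrite mulr0.
  by apply: Hc; rewrite ltn_neqAle ki andbT eq_sym.
rewrite (bigD1 k) //= addrC; congr (_ + _).
rewrite [RHS](bigD1 k) //= eqxx rmorph0 scale0r add0r.
by apply: eq_bigr => i /negPf->.
Qed.

Lemma flag_mono r (b : 'I_r -> V) k k' : (k <= k')%N -> flag b k `<=` flag b k'.
Proof.
move=> kk _ [c [-> Hc]]; exists c; split=> // i ki.
exact/Hc/(leq_trans kk).
Qed.

Lemma length_le_span r (b : 'I_r -> V) :
  length_le f r (lin_span f (fun i => f t *: b i)) (lin_span f b).
Proof.
rewrite -flag0 -flag_full.
suff: forall k, (k <= r)%N -> length_le f k (flag b 0) (flag b k) by apply.
elim=> [_|k IH kr]; first exact: length_le_refl.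
rewrite -[X in length_le _ X]addn1; apply: length_le_trans (IH (ltnW kr)) _.
- exact: submod_flag.
- exact: submod_flag.
- exact: flag_mono.
- exact: flag_mono.
apply: length_le_sub (fun v => id) (@flag_step _ b (Ordinal kr)) _.
apply: length_le_simple => L; apply: adjoin_simple; first exact: submod_flag.
exists (fun i => (i == Ordinal kr)%:R * t); split; last first.
  by move=> i _; exists (i == Ordinal kr)%:R; rewrite mulrC.
rewrite (bigD1 (Ordinal kr)) //= eqxx mul1r big1 ?addr0 // => i /negPf->.
by rewrite mul0r rmorph0 scale0r.
Qed.

Lemma length_le_span_exp r (b : 'I_r -> V) N :
  length_le f (N * r) (lin_span f (fun i => f t ^+ N *: b i)) (lin_span f b).
Proof.
have le N' (b' := fun i => f t ^+ N' *: b i) :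
    lin_span f (fun i => f t ^+ N'.+1 *: b i) = lin_span f (fun i => f t *: b' i).
  by congr lin_span; apply/funext => i; rewrite exprS scalerA.
have sub (b' : 'I_r -> V) : lin_span f (fun i => f t *: b' i) `<=` lin_span f b'.
  apply: lin_span_sub; first exact: submod_lin_span.
  by move=> i; have [_ _ Z] := submod_lin_span b'; apply/Z/mem_lin_span.
have sub' N' : lin_span f (fun i => f t ^+ N' *: b i) `<=` lin_span f b.
  elim: N' => [|N' IH]; last by rewrite le; exact: subset_trans (sub _) _.
  by apply: lin_span_sub; [exact: submod_lin_span|move=> i; rewrite expr0 scale1r; exact: mem_lin_span].
elim: N => [|N IH].
  have -> : lin_span f (fun i => f t ^+ 0 *: b i) = lin_span f b.
    by congr lin_span; apply/funext => i; rewrite expr0 scale1r.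
  exact: length_le_refl.
rewrite mulSn le.
by apply: (length_le_trans (B := lin_span f (fun i => f t ^+ N *: b i))) IH;
  [exact: submod_lin_span|exact: submod_lin_span| | |exact: length_le_span].
Qed.

(** Freeness makes the steps of the flag strict: the coordinate of [b k] at [k] is 1, which [t] does
    not divide. *)
Lemma chain_span r (b : 'I_r -> V) :
  (forall c : 'I_r -> S, \sum_i f (c i) *: b i = 0 -> forall i, c i = 0) ->
  exists c, chain_in f c r (lin_span f (fun i => f t *: b i)) (lin_span f b).
Proof.
move=> free; exists (flag b); rewrite -flag0 -flag_full; split=> [i ir|i ir].
  by split; [exact: submod_flag|exact: flag_mono|exact: flag_mono].
split; first exact: flag_mono.
pose k := Ordinal ir; move=> E.
have : flag b i.+1 (b k).
  exists (fun j => (j == k)%:R); split.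
    by rewrite (bigD1 k) //= eqxx rmorph1 scale1r big1 ?addr0 // => j /negPf->;
       rewrite rmorph0 scale0r.
  move=> j ij; exists 0; rewrite mulr0; case: eqVneq => // jk.
  by move: ij; rewrite jk ltnn.
rewrite -E => -[c [bE Hc]].
have := free (fun j => c j - (j == k)%:R).
have -> : \sum_j f (c j - (j == k)%:R) *: b j = 0.
  under eq_bigr do rewrite rmorphB scalerBl; rewrite sumrB -bE [X in _ - X](bigD1 k) //=.
  rewrite eqxx rmorph1 scale1r big1 ?addr0 ?subrr // => j /negPf->.
  by rewrite rmorph0 scale0r.
move=> /(_ erefl k) /eqP; rewrite eqxx subr_eq0 => /eqP ck.
have [d dE] := Hc k (leqnn _); have := congr1 red (etrans (esym ck) dE).
by rewrite rmorph1 rmorphM (strict_red_unif st) mul0r => /eqP; rewrite oner_eq0.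
Qed.

End Lengths.

(** * Base change of modules and of bounds on lengths *)

Section BaseChange.
Variables (Q : fieldType) (V : lmodType Q) (S S' : idomainType).
Variables (f : {rmorphism S -> Q}) (g : {rmorphism S' -> Q}).
Variable w : S -> S'.
Hypothesis fE : forall a, f a = g (w a).
Implicit Types (A B L P : set V).

Lemma submod_restrict P : is_submod g P -> is_submod f P.
Proof. by case=> P0 PD PZ; split=> // a v Pv; rewrite fE; exact: PZ. Qed.

Lemma submod_base_change L : is_submod g (base_change g L).
Proof.
split.
- exists 0%N, (fun=> 0), (fun=> 0); split; first by case.
  by rewrite big_ord0.
- move=> _ _ [r [c [b [Lb ->]]]] [s [d [e [Le ->]]]].
  exists (r + s)%N, (fun i : 'I_(r + s) => match fintype.split i with inl j => c j | inr j => d j end).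
  exists (fun i : 'I_(r + s) => match fintype.split i with inl j => b j | inr j => e j end); split.
    by move=> i; case: fintype.split.
  rewrite big_split_ord /=; congr (_ + _); apply: eq_bigr => i _.
    by rewrite (unsplitK (inl i)).
  by rewrite (unsplitK (inr i)).
- move=> a _ [r [c [b [Lb ->]]]]; exists r, (fun i => a * c i), b; split=> //.
  by rewrite scaler_sumr; apply: eq_bigr => i _; rewrite rmorphM scalerA.
Qed.

Lemma sub_base_change L : L `<=` base_change g L.
Proof.
move=> v Lv; exists 1%N, (fun=> 1), (fun=> v); split=> //.
by rewrite big_ord1 rmorph1 scale1r.
Qed.

Lemma base_change_sub L P : is_submod g P -> L `<=` P -> base_change g L `<=` P.
Proof.
move=> sP LP _ [r [c [b [Lb ->]]]]; apply: (submod_sum _ sP) => i _.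
by have [_ _ PZ] := sP; apply/PZ/LP.
Qed.

Lemma base_change_span r (b : 'I_r -> V) :
  base_change g (lin_span f b) = lin_span g b.
Proof.
apply/seteqP; split.
  apply: base_change_sub; first exact: submod_lin_span.
  apply: lin_span_sub; last exact: mem_lin_span.
  exact/submod_restrict/submod_lin_span.
apply: lin_span_sub; first exact: submod_base_change.
by move=> i; apply/sub_base_change/mem_lin_span.
Qed.

(** A simple step adjoins a single vector [e], with [t e] in [A]. Its base change is still generated
    by [e], and since [w t] is a uniformizer of [S'], that step is simple or trivial. *)
Lemma length_le_base_change (t : S) (R' : fieldType) (red : {rmorphism S' -> R'})
    x A B :
  strict_ring (w t) red -> (forall v, B v -> A (f t *: v)) ->
  incl_length f x A B -> length_le g x (base_change g A) (base_change g B).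
Proof.
move=> st BA [c [c0 cx sub simple]].
have mono i j : (i <= j)%N -> (j <= x)%N -> c i `<=` c j.
  elim: j => [|j IH]; first by rewrite leqn0 => /eqP-> _ v.
  rewrite leq_eqVlt => /orP[/eqP-> _ v //|ij jx] v /(IH ij (ltnW jx)).
  by have [le _ _] := simple j jx; exact: le.
have bmono i j : (i <= j)%N -> (j <= x)%N -> base_change g (c i) `<=` base_change g (c j).
  move=> ij jx; apply: base_change_sub; first exact: submod_base_change.
  exact: subset_trans (mono _ _ ij jx) (@sub_base_change _).
rewrite -c0 -cx.
suff: forall i, (i <= x)%N -> length_le g i (base_change g (c 0%N)) (base_change g (c i)).
  by apply.
elim=> [_|i IH ix]; first exact: length_le_refl.
have [le ne simp] := simple i ix.
rewrite -[X in length_le _ X]addn1; apply: length_le_trans (IH (ltnW ix)) _.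
- exact: submod_base_change.
- exact: submod_base_change.
- exact: bmono (ltnW ix).
- exact: bmono.
have [e [ce nce]] : exists e, c i.+1 e /\ ~ c i e.
  apply: contrapT => H; apply: ne; apply/seteqP; split=> // v cv.
  by apply: contrapT => ncv; apply: H; exists v.
have cE : c i.+1 = adjoin f (c i) e.
  have sA := submod_adjoin e (sub i (ltnW ix)).
  have [E|->//] := simp _ sA (@sub_adjoin _ _ _ f _ e)
    (adjoin_sub (sub _ ix) le ce).
  by case: nce; rewrite -E; exact/mem_adjoin/(sub _ (ltnW ix)).
have sA' := submod_adjoin (f := g) e (submod_base_change (c i)).
apply: (length_le_sub (B := adjoin g (base_change g (c i)) e)) (fun v => id) _ _.
  apply: base_change_sub => //; rewrite cE => _ [v [s [cv ->]]].
  exists v, (w s); rewrite fE; split=> //; exact: sub_base_change.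
apply: length_le_simple => L; apply: (adjoin_simple st); first exact: submod_base_change.
rewrite -fE; apply/sub_base_change/(mono 0%N) => //; first exact: ltnW.
by rewrite c0; apply: BA; rewrite -cx; exact: (mono i.+1).
Qed.

End BaseChange.

(** * Fixed points of the Frobenius *)

Section BaseDataTheory.
Variables (p : nat) (D : base_data p).

HB.instance Definition _ := GRing.RMorphism.copy (@ik p D) (@tofrac (Wk D)).
HB.instance Definition _ :=
  GRing.RMorphism.copy (@iq2 p D) (frac_map D \o @tofrac (Wq2 D)).

Let q := #|resF D|.

Lemma strict_Wk : strict_ring (witt_alg (Wk D) (unif D)) (witt_red (Wk D)).
Proof. exact: witt_strict. Qed.

Lemma strict_Wq2 : strict_ring (witt_alg (Wq2 D) (unif D)) (witt_red (Wq2 D)).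
Proof. exact: witt_strict. Qed.

Lemma iq2E a : iq2 a = ik (witt_map D a).
Proof. exact: frac_mapE. Qed.

Lemma ik_inj : injective (@ik p D).
Proof. by move=> x y /eqP; rewrite tofrac_eq => /eqP. Qed.

Lemma bpi_neq0 : bpi D != 0.
Proof. by rewrite tofrac_eq0; exact: strict_unif_neq0 strict_Wk. Qed.

Lemma sigma_ik x : sigma D (ik x) = ik (wsigma D x).
Proof. exact: sigmaE. Qed.

Lemma sigma_bpi : sigma D (bpi D) = bpi D.
Proof. by rewrite sigmaE wsigma_alg. Qed.

Lemma bpi_clear (x : Fk D) : exists N w, bpi D ^+ N * x = ik w.
Proof. exact: strict_frac strict_Wk x. Qed.

Lemma frob2_red (a : Wk D) :
  witt_red (Wk D) (wsigma D (wsigma D a)) = witt_red (Wk D) a ^+ (q * q).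
Proof. by rewrite !wsigma_red exprM. Qed.

Lemma q_gt0 : (0 < q)%N.
Proof. by apply/card_gt0P; exists 0. Qed.

Lemma frob2_root (x : bk D) : exists y, y ^+ (q * q) = x.
Proof.
have q0 : (0 < q * q)%N by rewrite muln_gt0 q_gt0.
have [y yE] := solve_monicpoly (fun i => if i == 0%N then x else 0) q0.
exists y; rewrite yE; case: (q * q)%N q0 => // k _.
by rewrite big_ord_recl /= expr0 mulr1 big1 ?addr0 // => i _; rewrite mul0r.
Qed.

(** The residue field of [E] already provides [q^2] roots of [X^(q^2) - X]; one more would exceed
    the degree. *)
Lemma frob2_fixed (x : bk D) : x ^+ (q * q) = x ->
  exists e, x = bk_incl D (kappa_incl D e).
Proof.
move=> fx; pose F : resE (bE D) -> bk D := bk_incl D \o kappa_incl D.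
have Finj : injective F by exact: inj_comp (fmorph_inj _) (fmorph_inj _).
suff /mapP [e _ ->] : x \in map F (enum (resE (bE D))) by exists e.
apply: contraT => nx.
have q1 : (1 < q * q)%N.
  have : (1 < #|resE (bE D)|)%N by rewrite finNzRing_gt1.
  by rewrite resE_card -mulnn.
have size_P : size ('X^(q * q) - 'X : {poly bk D}) = (q * q).+1.
  by rewrite size_polyDl size_polyXn // size_polyN size_polyX ltnS.
have P0 : 'X^(q * q) - 'X != 0 :> {poly bk D} by rewrite -size_poly_gt0 size_P.
have := max_poly_roots (rs := x :: map F (enum (resE (bE D)))) P0.
rewrite size_P /= size_map -cardE resE_card -mulnn ltnn.
move=> H; suff : false by []; apply: H.
  have rt y : y ^+ (q * q) = y -> root ('X^(q * q) - 'X) y.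
    by move=> fy; apply/rootP; rewrite hornerD hornerN hornerXn hornerX fy subrr.
  rewrite rt //=; apply/allP => _ /mapP [e _ ->]; apply: rt.
  by rewrite -rmorphXn mulnn -(resE_card (bE D)) expf_card.
by rewrite nx map_inj_uniq // enum_uniq.
Qed.

End BaseDataTheory.

(** * The dimension of the hermitian space *)

Section Eigenspaces.
Variables (K : fieldType) (V : vectType K) (s : {rmorphism K -> K}).

Lemma dim_semilinear (U U' : {vspace V}) (g : {additive V -> V}) :
  (forall a v, g (a *: v) = s a *: g v) ->
  (forall v, v \in U' -> exists2 w, w \in U & v = g w) -> (\dim U' <= \dim U)%N.
Proof.
move=> gZ surj; have sub : (U' <= span (map g (vbasis U)))%VS.
  apply/subvP => v /surj [w wU ->].
  rewrite (coord_vbasis wU) raddf_sum; apply: memv_suml => i _ /=.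
  by rewrite gZ; apply/memvZ/memv_span/map_f/mem_nth; rewrite size_tuple.
apply: leq_trans (dimvS sub) _; apply: leq_trans (dim_span _) _.
by rewrite size_map size_tuple.
Qed.

(** Since [s d = - d], the semilinear maps [F] and [G] interchange the eigenspaces of [f] for [d]
    and [- d], which therefore have the same dimension. As 2 is invertible and [f] squares to [d^2],
    they decompose [V]. *)
Lemma eigenspace_rank n r (b : 'I_r -> V) (f : {linear V -> V})
    (F G : {additive V -> V}) (d c : K) :
  \dim {:V} = n.*2 -> 2%:R != 0 :> K -> d != 0 -> s d = - d -> c != 0 ->
  (forall v, f (f v) = (d * d) *: v) ->
  (forall a v, F (a *: v) = s a *: F v) -> (forall a v, G (s a *: v) = a *: G v) ->
  (forall v, F (G v) = c *: v) ->
  (forall v, f (F v) = F (f v)) -> (forall v, f (G v) = G (f v)) ->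
  is_basis idfun [set v | f v = d *: v] b -> r = n.
Proof.
move=> dimV two_neq0 nz sd c0 ff FZ GZ FG fF fG.
pose phi : 'End(V) := linfun f.
pose E0 := lker (phi - d *: \1)%VF; pose E1 := lker (phi + d *: \1)%VF.
have mem0 v : v \in E0 <-> f v = d *: v.
  rewrite memv_ker add_lfunE ?opp_lfunE scale_lfunE id_lfunE lfunE /= subr_eq0.
  by split=> [/eqP|->].
have mem1 v : v \in E1 <-> f v = - d *: v.
  rewrite memv_ker add_lfunE ?opp_lfunE scale_lfunE id_lfunE lfunE /= addr_eq0 scaleNr.
  by split=> [/eqP|->].
have G0 v : v \in E0 -> G v \in E1.
  have sdN : s (- d) = d by rewrite rmorphN sd opprK.
  by move=> /mem0 h; apply/mem1; rewrite fG h -{1}sdN GZ.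
have G1 v : v \in E1 -> G v \in E0.
  by move=> /mem1 h; apply/mem0; rewrite fG h -sd GZ.
have FGE v : v = F (G (c^-1 *: v)).
  by rewrite FG scalerA divff ?scale1r.
have dimE : \dim E0 = \dim E1.
  apply/eqP; rewrite eqn_leq; apply/andP; split; apply: (dim_semilinear FZ) => v hv;
    by exists (G (c^-1 *: v)) => //; [apply/G0/memvZ || apply/G1/memvZ].
have cap : (E0 :&: E1 = 0)%VS.
  apply/eqP; rewrite -subv0; apply/subvP => v; rewrite memv_cap memv0.
  case/andP=> /mem0 h /mem1; rewrite h => /eqP; rewrite scaleNr -addr_eq0 -scalerDl.
  by rewrite scaler_eq0 -mulr2n -mulr_natl mulf_eq0 (negPf two_neq0) (negPf nz).
have sum : (E0 + E1 = fullv)%VS.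
  apply/eqP; rewrite eqEsubv subvf /=; apply/subvP => v _.
  have -> : v = 2%:R^-1 *: (v + d^-1 *: f v) + 2%:R^-1 *: (v - d^-1 *: f v).
    by rewrite -scalerDr addrACA subrr addr0 -mulr2n -scaler_nat scalerA mulVf ?scale1r.
  apply: memv_add; apply: memvZ; [apply/mem0|apply/mem1].
    by rewrite linearD linearZ /= ff scalerDr !scalerA divff // scale1r mulrA mulVf // mul1r addrC.
  rewrite linearB linearZ /= ff scalerBr !scalerA mulrA mulVf // mul1r mulNr divff //.
  by rewrite !scaleNr scale1r opprK addrC.
have dimn : \dim E0 = n.
  have := dimv_disjoint_sum cap; rewrite sum dimV -dimE addnn => /double_inj.
  by [].
case=> spanE freeE; rewrite -dimn.
pose X := [tuple b i | i < r].
have Xi (i : 'I_r) : X`_i = b i by rewrite -tnth_nth tnth_mktuple.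
have fX : free X.
  apply/freeP => k k0; apply: freeE; rewrite -[RHS]k0; apply: eq_bigr => i _.
  by rewrite Xi.
have sX : span X = E0.
  apply/eqP; rewrite eqEsubv; apply/andP; split.
    apply/span_subvP => v /tnthP [i ->]; rewrite tnth_mktuple; apply/mem0.
    suff : [set v | f v = d *: v] (b i) by [].
    rewrite spanE; exact: (mem_lin_span idfun).
  apply/subvP => v /mem0 vE; have : [set v | f v = d *: v] v by [].
  rewrite spanE => -[k ->].
  apply: memv_suml => i _; apply: memvZ; rewrite -Xi; apply: memv_span.
  by apply: mem_nth; rewrite size_tuple.
by rewrite -sX; move: fX; rewrite /free size_tuple => /eqP.
Qed.

End Eigenspaces.

Section QuadraticAction.
Variables (K0 : fieldType) (E : fieldExtType K0) (K : fieldType) (V : vectType K).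
Variables (s : {rmorphism K -> K}) (psi : {rmorphism E -> K}) (e : E).
Variables (n r : nat) (b : 'I_r -> V) (act : E -> {linear V -> V}).
Variables (F G : {additive V -> V}) (c : K).
Hypothesis dimE : \dim {:E} = 2%N.
Hypothesis s_psi : forall x : K0, s (psi x%:A) = psi x%:A.
Hypothesis s_e : s (psi e) = - psi e.
Hypothesis e_neq0 : psi e != 0.
Hypothesis two_neq0 : 2%:R != 0 :> K.

(** [psi e] changes sign under [s] while scalars of [K0] are fixed, so [e] is not a scalar, and
    applying [s] to [e^2 = x + y e] gives [y = 0]. The condition on all of [E] that defines the
    eigenspace thus becomes a single equation for [e]. *)
Lemma quadratic_generator :
  (exists x : K0, e * e = x%:A) /\ forall a : E, exists x y : K0, a = x%:A + y%:A * e.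
Proof.
have ne (x : K0) : e <> x%:A.
  move=> ex; have := s_psi x; rewrite -ex s_e => /eqP.
  by rewrite eq_sym -addr_eq0 -mulr2n -mulr_natl mulf_eq0 (negPf two_neq0) (negPf e_neq0).
have fr : free [:: 1; e].
  rewrite free_cons seq1_free span_seq1.
  apply/andP; split; last by apply/eqP=> e0; apply: (ne 0); rewrite scale0r.
  apply/negP => /vlineP [k k1]; have k0 : k != 0.
    by apply/eqP => k0; move: k1; rewrite k0 scale0r => /eqP; rewrite oner_eq0.
  by apply: (ne k^-1); rewrite k1 scalerA mulVf ?scale1r.
have full : span [:: 1; e] = fullv.
  apply/eqP; rewrite eqEdim subvf /= dimE.
  by move: fr; rewrite /free => /eqP->.
have dec (a : E) : exists x y : K0, a = x%:A + y%:A * e.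
  have : a \in span [:: 1; e] by rewrite full memvf.
  rewrite span_cons span_seq1 => /memv_addP [u /vlineP [x ->] [w /vlineP [y ->] ->]].
  by exists x, y; rewrite mulr_algl.
split=> //; have [x [y e2]] := dec (e * e); exists x; rewrite e2.
have psi2 : psi e * psi e = psi x%:A + psi y%:A * psi e by rewrite -!rmorphM -rmorphD e2.
have := congr1 s psi2; rewrite rmorphD !rmorphM !s_psi s_e.
rewrite mulrNN psi2 mulrN => /eqP; rewrite (can_eq (addKr _)) -addr_eq0 -mulr2n.
rewrite -mulr_natl mulf_eq0 (negPf two_neq0) mulf_eq0 (negPf e_neq0) orbF /=.
by rewrite fmorph_eq0 => /eqP->; rewrite mul0r addr0.
Qed.

Hypothesis dimV : \dim {:V} = n.*2.
Hypothesis c_neq0 : c != 0.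
Hypothesis actD : forall x y v, act (x + y) v = act x v + act y v.
Hypothesis actM : forall x y v, act (x * y) v = act x (act y v).
Hypothesis act_scalar : forall (x : K0) v, act x%:A v = psi x%:A *: v.
Hypothesis F_semilinear : forall a v, F (a *: v) = s a *: F v.
Hypothesis G_semilinear : forall a v, G (s a *: v) = a *: G v.
Hypothesis FG : forall v, F (G v) = c *: v.
Hypothesis act_F : forall x v, act x (F v) = F (act x v).
Hypothesis act_G : forall x v, act x (G v) = G (act x v).

Lemma common_eigenspace_rank :
  is_basis idfun [set v | forall a, act a v = psi a *: v] b -> r = n.
Proof.
have [[x e2] dec] := quadratic_generator.
have -> : [set v | forall a, act a v = psi a *: v] = [set v | act e v = psi e *: v].
  apply/seteqP; split=> v /= ev => [//|a]; have [y [z ->]] := dec a.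
  by rewrite actD actM ev !act_scalar scalerA -scalerDl rmorphD rmorphM.
have ee v : act e (act e v) = (psi e * psi e) *: v.
  by rewrite -actM e2 act_scalar -e2 rmorphM.
exact: (eigenspace_rank dimV two_neq0 e_neq0 s_e c_neq0 ee F_semilinear G_semilinear FG
  (act_F e) (act_G e)).
Qed.

End QuadraticAction.

Section Dimension.
Variables (p : nat) (D : base_data p).
Hypotheses (p_prime : prime p) (p_odd : odd p).

Lemma two_neq0 : 2%:R != 0 :> Fk D.
Proof.
have Z2 : 2%:R != 0 :> Defs.Zp D.
  apply/eqP => /(congr1 (Zp_red D)); rewrite rmorph0 rmorph_nat => /eqP.
  rewrite -(dvdn_pcharf (pchar_Fp p_prime)) dvdn_prime2 // => /eqP p2.
  by move: p_odd; rewrite p2.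
have : tofrac (2%:R : Defs.Zp D) != 0 by rewrite tofrac_eq0.
rewrite rmorph_nat => F2.
have : in_alg D 2%:R != 0 by rewrite fmorph_eq0.
rewrite rmorph_nat => F3.
have : in_alg (bE D) 2%:R != 0 by rewrite fmorph_eq0.
rewrite rmorph_nat => F4.
have : frac_map D (phi0 D 2%:R) != 0 by rewrite !fmorph_eq0.
by rewrite !rmorph_nat.
Qed.

Lemma OF_frac (x : D) : exists a b : OF D, int_val b != 0 /\ int_val b * x = int_val a.
Proof.
have [d [d0 dx]] := integral_multiple x.
have di : integralOver (in_alg D \o @tofrac (Defs.Zp D)) ((tofrac d)%:A) := integral_id _ d.
have /asboolP di' := di; have /asboolP dx' := dx.
exists (IntRing dx'), (IntRing di'); split=> /=; last by rewrite mulrC.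
by rewrite -[X in X != 0]/(in_alg D _) fmorph_eq0 tofrac_eq0.
Qed.

Let algM (x y : D) : (x * y)%:A = x%:A * y%:A :> bE D.
Proof. exact: (rmorphM (in_alg (bE D))). Qed.

Lemma frac_map_phi0_OF (a : OF D) :
  frac_map D (phi0 D (int_val a)%:A) = ik (witt_alg (Wk D) a).
Proof. by rewrite phi0_alg frac_mapE witt_map_alg. Qed.

Lemma sigma_phi0 (x : D) :
  sigma D (frac_map D (phi0 D x%:A)) = frac_map D (phi0 D x%:A).
Proof.
have [a [b [b0 bx]]] := OF_frac x.
have sOF (c : OF D) : sigma D (frac_map D (phi0 D (int_val c)%:A)) =
    frac_map D (phi0 D (int_val c)%:A).
  by rewrite frac_map_phi0_OF sigma_ik wsigma_alg.
have E : frac_map D (phi0 D (int_val b)%:A) * frac_map D (phi0 D x%:A) =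
    frac_map D (phi0 D (int_val a)%:A).
  by rewrite -bx algM !rmorphM.
have nz : frac_map D (phi0 D (int_val b)%:A) != 0.
  by rewrite !fmorph_eq0 -[X in X != 0]/(in_alg (bE D) _) fmorph_eq0.
by apply: (mulfI nz); rewrite -{1}sOF -rmorphM E sOF.
Qed.

Variables (n : nat) (N : isocrystal D n).

Lemma act_scalar (x : D) (v : N) : act N x%:A v = frac_map D (phi0 D x%:A) *: v.
Proof.
have [a [b [b0 bx]]] := OF_frac x.
have E : (int_val b)%:A * x%:A = (int_val a)%:A :> bE D.
  by rewrite -bx algM.
have nz : frac_map D (phi0 D (int_val b)%:A) != 0.
  by rewrite !fmorph_eq0 -[X in X != 0]/(in_alg (bE D) _) fmorph_eq0.
apply: (scalerI nz); rewrite scalerA -!rmorphM E !frac_map_phi0_OF.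
by rewrite -!act_alg -actM E.
Qed.

Let del : Fk D := iq2 (delta D).

Lemma sigma_delta : sigma D del = - del.
Proof. by rewrite /del iq2E sigma_ik delta_sigma rmorphN. Qed.

Lemma del_neq0 : del != 0.
Proof.
rewrite /del fmorph_eq0 tofrac_eq0; apply/eqP => d0.
by have := delta_unit D; rewrite d0 unitr0.
Qed.

Lemma Nk0_basis_size r (b : 'I_r -> N) : is_basis idfun (Nk0 N) b -> r = n.
Proof.
(* The element of [E] corresponding to [delta] is the required generator, because [sigma] acts on
   [delta] by -1. *)
have [g _ gK] := phi0_bij D; pose e := g (tofrac (delta D)).
have eE : frac_map D (phi0 D e) = del by rewrite /e gK.
unshelve epose proof (@common_eigenspace_rank (pF D) (bE D) (Fk D) (Nk N) (sigma D)
  (frac_map D \o phi0 D) e n r b (@act p D n N) (Fr N) (Ve N) (bpi D) (qE_dim (bE D))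
  sigma_phi0 _ _ two_neq0 (Nk_dim N) (bpi_neq0 D) (@actD p D n N) (@actM p D n N)
  act_scalar (@Fr_semilinear p D n N) (@Ve_semilinear p D n N) (@FrVe p D n N)
  (@act_Fr p D n N) (@act_Ve p D n N)) as H.
- by rewrite /= eE sigma_delta.
- by rewrite /= eE del_neq0.
exact_no_check H.
Qed.

End Dimension.

(** * Descent along a Frobenius-semilinear bijection *)

(** Take a matrix with rows in [U] of maximal rank. By maximality its row space contains [U]; as [U]
    is proper the rank is below [r], and a nonzero column of the cokernel matrix is the desired
    form. *)
Lemma proper_subspace_orthogonal (k : fieldType) r (U : set ('I_r -> k)) :
  U (fun=> 0) -> (forall u v, U u -> U v -> U (fun i => u i + v i)) ->
  (forall a u, U u -> U (fun i => a * u i)) -> (exists u, ~ U u) ->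
  exists l, (exists i, l i != 0) /\ forall u, U u -> \sum_i l i * u i = 0.
Proof.
move=> U0 UD UZ [u0 nU].
pose P d := `[< exists m (A : 'M[k]_(m, r)), (forall i, U (A i)) /\ \rank A = d >].
have exP : exists d, P d.
  by exists 0%N; apply/asboolP; exists 0%N, 0; split; [case|rewrite mxrank0].
have leP d : P d -> (d <= r)%N by case/asboolP => m [A [_ <-]]; exact: rank_leq_col.
case: (ex_maxnP exP leP) => d /asboolP [m [A [UA rA]]] max.
have inA u : U u -> (\row_i u i <= A)%MS.
  move=> Uu.
  have le : (A <= col_mx A (\row_i u i))%MS by rewrite -addsmxE addsmxSl.
  have le' : (\row_i u i <= col_mx A (\row_i u i))%MS by rewrite -addsmxE addsmxSr.
  have /max leB : P (\rank (col_mx A (\row_i u i))).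
    apply/asboolP.
    exists (m + 1)%N, (col_mx A (\row_i u i)); split=> // i.
    case: (fintype.splitP i) => i' iE.
      have -> : col_mx A (\row_i u i) i = A i' :> ('I_r -> k).
        by apply/funext => j; rewrite (_ : i = lshift 1 i') ?col_mxEu //; exact: val_inj.
      exact: UA.
    have -> : col_mx A (\row_i u i) i = u :> ('I_r -> k).
      apply/funext => j; rewrite (_ : i = rshift m i') ?col_mxEd ?mxE //; exact: val_inj.
    exact: Uu.
  apply: submx_trans le' _; rewrite -(mxrank_leqif_sup le).
  by rewrite eqn_leq mxrankS // rA.
have ltA : (\rank A < r)%N.
  rewrite ltn_neqAle rank_leq_col andbT; apply/negP => fullA; apply: nU.
  have /submxP [x xE] : (\row_i u0 i <= A)%MS by apply: submx_full.
  have -> : u0 = fun i => \sum_j x 0 j * A j i.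
    by apply/funext => i; have := congr1 (fun B : 'rV_r => B 0 i) xE; rewrite !mxE.
  elim: (index_enum _) => [|j s IH].
    by rewrite (_ : (fun i => _) = fun=> 0) //; apply/funext => i; rewrite big_nil.
  rewrite (_ : (fun i => _) = fun i => x 0 j * A j i + \sum_(j <- s) x 0 j * A j i).
    by apply: UD IH; apply: UZ.
  by apply/funext => i; rewrite big_cons.
have : cokermx A != 0 by rewrite -mxrank_eq0 mxrank_coker subn_eq0 -ltnNge.
case/matrix0Pn => i [j cij]; exists (fun i => cokermx A i j).
split; first by exists i.
move=> u /inA; rewrite submxE => /eqP /matrixP /(_ 0 j).
by rewrite !mxE => uE; rewrite -[RHS]uE; apply: eq_bigr => l _; rewrite !mxE mulrC.
Qed.

Section FixedScalars.
Variables (K2 K : fieldType) (j : {rmorphism K2 -> K}) (sK : {rmorphism K -> K}).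
Variables (V : vectType K) (tau : V -> V) (N0 : set V).
Hypothesis tauZ : forall a v, tau (a *: v) = sK a *: tau v.

Let C : set V := [set v | N0 v /\ tau v = v].

Definition full_basis r (b : 'I_r -> V) := is_basis j C b /\ N0 `<=` lin_span idfun b.

(** [C] is stable under [j x] and consists of [tau]-fixed vectors, so any nonzero vector of [C]
    forces [sK] to fix [j x]. There is one because [N0] is nonzero and contained in the span of
    [C]. *)
Lemma fixed_scalars r (b : 'I_r -> V) r' (a : 'I_r' -> V) : (0 < r')%N ->
  is_basis idfun N0 a -> full_basis b -> forall x, sK (j x) = j x.
Proof.
move=> r'0 [N0a freea] [[Cb freeb] N0b] x.
have r0 : (0 < r)%N.
  rewrite lt0n; apply/eqP => r0; subst r; pose i := Ordinal r'0.
  have : N0 (a i) by rewrite N0a; exact: (mem_lin_span idfun).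
  move=> /N0b [c aE]; rewrite big_ord0 in aE.
  have /freea /(_ i) /eqP : \sum_l idfun ((l == i)%:R : K) *: a l = 0.
    by rewrite (bigD1 i) //= aE scaler0 add0r big1 // => l /negPf->; rewrite scale0r.
  by rewrite eqxx oner_eq0.
pose i := Ordinal r0; have sC : is_submod j C by rewrite Cb; exact: submod_lin_span.
have Cbi : C (b i) by rewrite Cb; exact: mem_lin_span.
have [_ _ CZ] := sC; have [_] := CZ x _ Cbi.
rewrite tauZ Cbi.2 => /eqP; rewrite -subr_eq0 -scalerBl scaler_eq0.
case/orP=> [|/eqP b0]; first by rewrite subr_eq0 => /eqP.
have /freeb /(_ i) /eqP : \sum_l j ((l == i)%:R : K2) *: b l = 0.
  rewrite (bigD1 i) //= b0 scaler0 add0r big1 // => l /negPf->.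
  by rewrite rmorph0 scale0r.
by rewrite eqxx oner_eq0.
Qed.

End FixedScalars.

Section SemilinearDescent.
Variables (S2 S : idomainType) (K2 K k : fieldType).
Variables (w : {rmorphism S2 -> S}) (f2 : {rmorphism S2 -> K2}).
Variables (f : {rmorphism S -> K}) (j : {rmorphism K2 -> K}) (g2 : {rmorphism S2 -> K}).
Variables (R2 : fieldType) (red2 : {rmorphism S2 -> R2}).
Variables (t : S2) (varpi : S) (red : {rmorphism S -> k}) (q : nat).
Variables (s : {rmorphism S -> S}) (sK : {rmorphism K -> K}).
Hypothesis f_inj : injective f.
Hypothesis g2E : forall a, g2 a = f (w a).
Hypothesis jf2 : forall a, j (f2 a) = g2 a.
Hypothesis wt : w t = varpi.
Hypothesis st2 : strict_ring t red2.
Hypothesis st : strict_ring varpi red.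
Hypothesis clearK : forall x : K, exists N y, f varpi ^+ N * x = f y.
Hypothesis s_t : s varpi = varpi.
Hypothesis sKf : forall a, sK (f a) = f (s a).
Hypothesis red_s : forall a, red (s a) = red a ^+ q.
Hypothesis sKj : forall a, sK (j a) = j a.
Hypothesis fixk : forall x, x ^+ q = x -> exists a, x = red (w a).
Hypothesis rootk : forall x : k, exists y, y ^+ q = x.
Hypothesis q_gt0 : (0 < q)%N.

Variables (V : vectType K) (tau : V -> V) (N0 : set V).
Hypothesis tauD : forall u v, tau (u + v) = tau u + tau v.
Hypothesis tauZ : forall a v, tau (a *: v) = sK a *: tau v.
Implicit Types (M L P : set V).

Local Notation C := [set v : V | N0 v /\ tau v = v].

Let pi : K := f varpi.

Let pi_neq0 : pi != 0.
Proof. by rewrite -(rmorph0 f) (inj_eq f_inj); exact: strict_unif_neq0 st. Qed.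

Let g2t : g2 t = pi.
Proof. by rewrite g2E wt. Qed.

(** Additivity of the [q]-power map is read off from the ring morphism [s] lifting it. *)
Let frobD (x y : k) : (x + y) ^+ q = x ^+ q + y ^+ q.
Proof.
have [a <-] := strict_surj st x; have [b <-] := strict_surj st y.
by rewrite -rmorphD -!red_s !rmorphD.
Qed.

Let frob0 : 0 ^+ q = 0 :> k.
Proof. by rewrite expr0n eqn0Ngt q_gt0. Qed.

Let frob_inj (x y : k) : x ^+ q = y ^+ q -> x = y.
Proof.
move=> e; have := frobD (x - y) y; rewrite subrK e -{1}[y ^+ q]add0r => /addIr /esym/eqP.
by rewrite expf_eq0 q_gt0 /= subr_eq0 => /eqP.
Qed.

Let frob_sum r (F : 'I_r -> k) : (\sum_i F i) ^+ q = \sum_i F i ^+ q.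
Proof. exact: (big_morph (fun x => x ^+ q) frobD frob0). Qed.

Let tau0 : tau 0 = 0.
Proof. by rewrite -(scale0r (0 : V)) tauZ rmorph0 !scale0r. Qed.

Let tau_sum I (r : seq I) (F : I -> V) : tau (\sum_(i <- r) F i) = \sum_(i <- r) tau (F i).
Proof. exact: (big_morph tau tauD tau0). Qed.

(** Digit by digit: the residue of a fixed element is fixed by the [q]-power map, hence rational;
    after subtracting a rational lift and dividing by [varpi] the element is again fixed. The digits
    sum up in [S2] by completeness. *)
Lemma fixS x : s x = x -> exists a, x = w a.
Proof.
have s_w a : s (w a) = w a by apply: f_inj; rewrite -sKf -g2E -jf2 sKj.
move=> fx; pose P y := s y = y.
(* Remainders carry the proof that they are fixed, so that the choice functions can be iterated. *)
have step (z : {y | P y}) : exists a, exists y : {y | P y},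
    sval z = w a + varpi * sval y.
  case: z => z fz /=.
  have /fixk [a aE] : red z ^+ q = red z by rewrite -red_s fz.
  have /(strict_ker st) [y yE] : red (z - w a) = 0 by rewrite rmorphB aE subrr.
  have fy : s y = y.
    apply: (mulfI (strict_unif_neq0 st)).
    by have := congr1 s yE; rewrite rmorphM s_t -yE rmorphB fz s_w => ->.
  by exists a, (exist P y fy); rewrite /= -yE addrC subrK.
have [a_ /choice [y_ yE]] := choice step.
pose z := fix z n := if n is n'.+1 then y_ (z n') else exist P x fx.
pose u n := \sum_(i < n) t ^+ i * a_ (z i).
have xE n : x = w (u n) + varpi ^+ n * sval (z n).
  elim: n => [|n IH]; first by rewrite /u big_ord0 rmorph0 add0r mul1r.
  rewrite [LHS]IH /u big_ord_recr /= rmorphD -addrA; congr (_ + _).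
  by rewrite {1}yE rmorphM rmorphXn wt mulrDr mulrA -exprSr.
have [a aE] : exists a, forall n, exists y, a - u n = t ^+ n * y.
  apply: (strict_complete st2) => n; exists (a_ (z n)).
  by rewrite /u big_ord_recr addrAC subrr add0r.
exists a; apply/eqP; rewrite -subr_eq0; apply/eqP.
apply: (strict_separated st) => n; have [y yn] := aE n.
exists (sval (z n) - w y).
have -> : a = u n + t ^+ n * y by rewrite -yn addrC subrK.
rewrite [X in X - _](xE n) rmorphD rmorphM rmorphXn wt.
by rewrite opprD addrACA subrr add0r mulrBr.
Qed.

Lemma fixK x : sK x = x -> exists a, x = j a.
Proof.
move=> fx; have [N [y yE]] := clearK x.
have /fixS [a aE] : s y = y.
  by apply: f_inj; rewrite -sKf -yE rmorphM rmorphXn sKf s_t fx.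
exists (f2 a / f2 t ^+ N); rewrite fmorph_div rmorphXn !jf2 g2t g2E -aE -yE.
by rewrite mulrC mulKf // expf_neq0.
Qed.

(** A digit expansion as in [fixS]; each digit is the image under [s] of a lift of a [q]-th root. *)
Lemma s_surj x : exists y, s y = x.
Proof.
have step x' : exists a, exists y, x' = s a + varpi * y.
  have [y0 yE] := rootk (red x'); have [a aE] := strict_surj st y0.
  have /(strict_ker st) [y xE] : red (x' - s a) = 0.
    by rewrite rmorphB red_s aE yE subrr.
  by exists a, y; rewrite -xE addrC subrK.
have [a_ /choice [y_ yE]] := choice step.
pose z := fix z n := if n is n'.+1 then y_ (z n') else x.
pose u n := \sum_(i < n) varpi ^+ i * a_ (z i).
have xE n : x = s (u n) + varpi ^+ n * z n.
  elim: n => [|n IH]; first by rewrite /u big_ord0 rmorph0 add0r mul1r.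
  rewrite [LHS]IH /u big_ord_recr /= rmorphD -addrA; congr (_ + _).
  by rewrite {1}(yE (z n)) rmorphM rmorphXn s_t mulrDr mulrA -exprSr.
have [y yu] : exists y, forall n, exists y', y - u n = varpi ^+ n * y'.
  apply: (strict_complete st) => n; exists (a_ (z n)).
  by rewrite /u big_ord_recr addrAC subrr add0r.
exists y; apply/eqP; rewrite -subr_eq0; apply/eqP.
apply: (strict_separated st) => n; have [y' y'E] := yu n; exists (s y' - z n).
have -> : y = u n + varpi ^+ n * y' by rewrite -y'E addrC subrK.
rewrite [X in _ - X](xE n) rmorphD rmorphM rmorphXn s_t.
by rewrite opprD addrACA subrr add0r mulrBr.
Qed.

(* Artin's argument: a shortest relation has coefficients fixed by [sK]. *)
Lemma fixed_basis_free r (b : 'I_r -> V) : is_basis j C b ->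
  forall c : 'I_r -> K, \sum_i c i *: b i = 0 -> forall i, c i = 0.
Proof.
move=> [Cb free] c; have bC i : C (b i) by rewrite Cb; exact: mem_lin_span.
move: {2}#|_| (leqnn #|[pred i | c i != 0]|) => m; elim: m c => [|m IH] c.
  by rewrite leqn0 => /pred0P c0 _ i; apply/eqP/negbNE/negbT; have := c0 i.
move=> cm c0; apply: contrapT => /existsNP [i0 /eqP nz].
pose c' i := c i / c i0.
have c'0 : \sum_i c' i *: b i = 0.
  rewrite -[RHS](scaler0 _ (c i0)^-1) -[in RHS]c0 scaler_sumr; apply: eq_bigr => i _.
  by rewrite scalerA mulrC.
have d0 : forall i, sK (c' i) - c' i = 0.
  apply: IH.
    rewrite -ltnS; apply: leq_trans cm; rewrite [X in (_ < X)%N](cardD1 i0) inE nz add1n ltnS.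
    apply: subset_leq_card; apply/fintype.subsetP => i; rewrite !inE.
    have [->|_] := eqVneq i i0; first by rewrite /c' divff // rmorph1 subrr eqxx.
    by apply: contra => /eqP ci; rewrite /c' ci mul0r rmorph0 subr0.
  under eq_bigr do rewrite scalerBl; rewrite sumrB c'0 subr0.
  rewrite -[RHS]tau0 -[in RHS]c'0 tau_sum; apply: eq_bigr => i _.
  by rewrite tauZ (bC i).2.
have /choice [a aE] : forall i, exists a, c' i = j a.
  by move=> i; apply: fixK; apply/eqP; rewrite -subr_eq0 d0.
have a0 : forall i, a i = 0.
  by apply: free; rewrite -[RHS]c'0; apply: eq_bigr => i _; rewrite aE.
by have := aE i0; rewrite a0 rmorph0 /c' divff // => /eqP; rewrite oner_eq0.
Qed.

Notation full_basis := (full_basis j tau N0).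

(** [M] contains a basis of [N0], so a single lattice of [C] whose base change covers [M] makes [C]
    span [N0]. *)
Lemma full_basis_of_cover r (b : 'I_r -> V) M : is_basis j C b ->
  is_form f idfun N0 M -> M `<=` base_change f (lin_span g2 b) -> full_basis b.
Proof.
move=> bas [r' [a [[N0a _] ->]]]; rewrite (base_change_span g2E) => sub.
split=> //; rewrite N0a; apply: lin_span_sub; first exact: submod_lin_span.
by move=> i; have [c ->] := sub _ (mem_lin_span f a i); exists (f \o c).
Qed.

(** The basis of [L] stays free over [K], so the coordinates of a [tau]-fixed vector are fixed by
    [sK] and hence rational. *)
Lemma base_change_cap L v : is_form g2 j C L -> base_change f L v -> C v -> L v.
Proof.
case=> r [b [bas ->]]; rewrite (base_change_span g2E) => -[c vE] [_ tv].
have bC i : C (b i) by case: bas => -> _; exact: mem_lin_span.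
have sc i : sK (f (c i)) - f (c i) = 0.
  apply: (fixed_basis_free bas (c := fun i => sK (f (c i)) - f (c i))).
  under eq_bigr do rewrite scalerBl; rewrite sumrB -vE -[X in _ - X]tv vE tau_sum.
  by rewrite -sumrB big1 // => l _; rewrite tauZ (bC l).2 subrr.
have /choice [a aE] : forall i, exists a, c i = w a.
  by move=> i; apply/fixS/f_inj/eqP; rewrite -sKf -subr_eq0 sc.
by exists a; rewrite vE; apply: eq_bigr => i _; rewrite g2E aE.
Qed.

(* Applied to the orthogonal of the reduction of [M], on which the inverse of the
   [q]-power map acts, Artin's argument produces a rational linear form. *)
Lemma rational_hyperplane r (b : 'I_r -> V) M :
  (forall i, tau (b i) = b i) -> is_submod f M -> (forall v, M v -> M (tau v)) ->
  (exists u : 'I_r -> k, forall c, M (\sum_i f (c i) *: b i) ->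
     ~ (forall i, u i = red (c i))) ->
  exists i0 (l : 'I_r -> S2), l i0 = 1 /\
    forall c, M (\sum_i f (c i) *: b i) -> exists d, \sum_i w (l i) * c i = varpi * d.
Proof.
move=> taub [M0 MD MZ] Mtau [u0 nu0].
pose U : set ('I_r -> k) := [set u | exists c, M (\sum_i f (c i) *: b i) /\
  forall i, u i = red (c i)].
pose orth (l : 'I_r -> k) := forall u, U u -> \sum_i l i * u i = 0.
have [l [[i1 li1] lU]] : exists l, (exists i, l i != 0) /\ orth l.
  apply: proper_subspace_orthogonal.
  - exists (fun=> 0); split; last by move=> i; rewrite rmorph0.
    by rewrite big1 // => i _; rewrite rmorph0 scale0r.
  - move=> u v [c [Mc uE]] [d [Md vE]]; exists (fun i => c i + d i); split.
      under eq_bigr do rewrite rmorphD scalerDl; rewrite big_split; exact: MD.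
    by move=> i; rewrite uE vE rmorphD.
  - move=> a u [c [Mc uE]]; have [a' aE] := strict_surj st a.
    exists (fun i => a' * c i); split; last by move=> i; rewrite uE rmorphM aE.
    move/(MZ a'): Mc; rewrite scaler_sumr; congr M; apply: eq_bigr => i _.
    by rewrite rmorphM scalerA.
  by exists u0 => -[c [/nu0]].
have Ufrob u : U u -> U (fun i => u i ^+ q).
  case=> c [Mc uE]; exists (fun i => s (c i)); split; last by move=> i; rewrite uE red_s.
  move/Mtau: Mc; rewrite tau_sum; congr M; apply: eq_bigr => i _.
  by rewrite tauZ sKf taub.
have [l' [i0 [l'U [l'1 l'f]]]] : exists l' i0,
    orth l' /\ (l' i0 = 1 /\ forall i, l' i ^+ q = l' i).
  have : exists i, l i != 0 by exists i1.
  move: {2}#|_| (leqnn #|[pred i | l i != 0]|) => m; elim: m l lU {i1 li1} => [|m IH] l lU lm.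
    by case=> i li; have := max_card; move: lm; rewrite leqn0 => /pred0P /(_ i); rewrite inE li.
  case=> i0 li0; pose l' i := l i / l i0.
  have l'U : orth l'.
    move=> u Uu; rewrite -[RHS](mulr0 (l i0)^-1) -[in RHS](lU u Uu) mulr_sumr.
    by apply: eq_bigr => i _; rewrite mulrCA mulrA.
  have l'1 : l' i0 = 1 by rewrite /l' divff.
  have [psi psiE] := choice (fun i => rootk (l' i)).
  (* The [q]-th power of the value of [psi] at [u] is the value of [l'] at the Frobenius twist of
     [u], which lies in [U] again. *)
  have psiU : orth psi.
    move=> u Uu; apply: frob_inj; rewrite frob_sum frob0 -[RHS](l'U _ (Ufrob u Uu)).
    by apply: eq_bigr => i _; rewrite exprMn psiE.
  (* This form vanishes wherever [l] does and also at [i0]: unless it is zero, it is a shorter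
     relation. *)
  pose d i := psi i - l' i.
  have dU : orth d.
    move=> u Uu; under eq_bigr do rewrite mulrBl.
    by rewrite sumrB psiU // l'U // subrr.
  have [[i di]|nd] := pselect (exists i, d i != 0); last first.
    exists l', i0; split=> //; split=> // i; rewrite -[RHS]psiE; congr (_ ^+ q).
    by apply/esym/eqP; rewrite -subr_eq0; apply: contrapT => /negP di; apply: nd; exists i.
  apply: (IH d) => //; last by exists i.
  rewrite -ltnS; apply: leq_trans lm; rewrite [X in (_ < X)%N](cardD1 i0) inE li0 add1n ltnS.
  apply: subset_leq_card; apply/fintype.subsetP => k'; rewrite !inE /d.
  have [->|_] := eqVneq k' i0.
    by rewrite l'1 (_ : psi i0 = 1) ?subrr ?eqxx //; apply: frob_inj; rewrite psiE l'1 expr1n.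
  apply: contra => /eqP lk; have l'k : l' k' = 0 by rewrite /l' lk mul0r.
  by rewrite l'k subr0; apply/eqP/frob_inj; rewrite psiE l'k frob0.
have /choice [a aE] := fun i => fixk (l'f i).
(* The lift at [i0] is exactly 1, not merely 1 modulo the uniformizer, as the change of basis below
   requires. *)
exists i0, (fun i => if i == i0 then 1 else a i); rewrite eqxx; split=> // c Mc.
apply/(strict_ker st); rewrite rmorph_sum -[RHS](l'U (fun i => red (c i))); last by exists c.
apply: eq_bigr => i _; rewrite rmorphM; case: eqVneq => [->|_]; last by rewrite -aE.
by rewrite !rmorph1 l'1.
Qed.

Section ElementaryChange.
Variables (r : nat) (b : 'I_r -> V) (i0 : 'I_r) (l : 'I_r -> S2).
Hypothesis li0 : l i0 = 1.

(** A basis of the sublattice on which the linear form with coefficients [l], normalized by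
    [l i0 = 1], takes values divisible by [varpi]. *)
Definition elementary_basis i :=
  if i == i0 then f varpi *: b i0 else b i - g2 (l i) *: b i0.

Let b' := elementary_basis.

Let conv (c : 'I_r -> K) i :=
  if i == i0 then pi * c i0 - \sum_(k | k != i0) g2 (l k) * c k else c i.

Let convE c : \sum_i c i *: b' i = \sum_i conv c i *: b i.
Proof.
rewrite (bigD1 i0) //= [RHS](bigD1 i0) //= /b' /elementary_basis /conv !eqxx.
rewrite (eq_bigr (fun i => c i *: b i - (g2 (l i) * c i) *: b i0)); last first.
  by move=> i /negPf->; rewrite scalerBr scalerA mulrC.
rewrite sumrB -scaler_suml scalerBl scalerA [c i0 * _]mulrC -addrA; congr (_ + _).
by rewrite addrC; congr (_ + _); apply: eq_bigr => i /negPf->.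
Qed.

(** Passes from coordinates in [b] to coordinates in the new basis: only the one at [i0] changes,
    becoming [pi^-1] times the value of the form. *)
Let unconv (c : 'I_r -> K) (d : K) i := if i == i0 then d else c i.

Let unconvE c d : pi * d = \sum_i g2 (l i) * c i ->
  \sum_i c i *: b i = \sum_i unconv c d i *: b' i.
Proof.
move=> dE; rewrite convE; apply: eq_bigr => i _; congr (_ *: _).
rewrite /conv /unconv eqxx; case: eqVneq => [->|//].
rewrite dE (bigD1 i0) //= li0 rmorph1 mul1r.
by rewrite [X in _ - X](eq_bigr (fun k => g2 (l k) * c k)) ?addrK // => i' /negPf->.
Qed.

Hypothesis full : full_basis b.

Let free := fixed_basis_free full.1.

Lemma elementary_full_basis : full_basis elementary_basis.
Proof.
have [[Cb _] N0b] := full.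
have sC : is_submod j C by rewrite Cb; exact: submod_lin_span.
have piE : pi = j (f2 t) by rewrite jf2 g2t.
split; last first.
  move=> v /N0b [c ->]; exists (unconv c (pi^-1 * \sum_i g2 (l i) * c i)).
  by rewrite /= -unconvE // mulVKf.
split.
  apply/seteqP; split.
    rewrite Cb => v [c ->].
    exists (fun i => if i == i0 then (f2 t)^-1 * \sum_i f2 (l i) * c i else c i).
    rewrite (unconvE (d := pi^-1 * \sum_i g2 (l i) * j (c i))) ?mulVKf //.
    apply: eq_bigr => i _; rewrite /unconv; case: eqP => // _; congr (_ *: _).
    rewrite rmorphM fmorphV -piE rmorph_sum; congr (_ * _).
    by apply: eq_bigr => i' _; rewrite rmorphM jf2.
  apply: lin_span_sub => // i; have [_ CD CZ] := sC.
  have bC i' : C (b i') by rewrite Cb; exact: mem_lin_span.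
  rewrite /b' /elementary_basis; case: eqP => _; first by rewrite -/pi piE; exact: CZ.
  by apply: (submodB sC) => //; rewrite -jf2; exact: CZ.
move=> c; rewrite (convE (j \o c)) => /free c0 i.
have ne i' : i' != i0 -> c i' = 0.
  by move=> /negPf ni; have := c0 i'; rewrite /conv ni /= => /eqP; rewrite fmorph_eq0 => /eqP.
have [->|/ne//] := eqVneq i i0; have := c0 i0; rewrite /conv eqxx big1 ?subr0 /=.
  by move/eqP; rewrite mulf_eq0 (negPf pi_neq0) fmorph_eq0 => /eqP.
by move=> i' /ne->; rewrite rmorph0 mulr0.
Qed.

Lemma elementary_sub : lin_span f elementary_basis `<=` lin_span f b.
Proof.
have sb := submod_lin_span f b; have [_ _ Z] := sb.
apply: lin_span_sub => // i; rewrite /b' /elementary_basis; case: eqP => _.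
  exact/Z/mem_lin_span.
by apply: (submodB sb); rewrite ?g2E; [|apply: Z]; exact: mem_lin_span.
Qed.

Lemma elementary_notin : ~ lin_span f elementary_basis (b i0).
Proof.
case=> c bE.
have : \sum_i (conv (f \o c) i - (i == i0)%:R) *: b i = 0.
  under eq_bigr do rewrite scalerBl; rewrite sumrB -convE -bE [X in _ - X](bigD1 i0) //=.
  rewrite eqxx scale1r big1 ?addr0 ?subrr // => i /negPf->; by rewrite scale0r.
move=> /free e; have ne i : i != i0 -> f (c i) = 0.
  by move=> /negPf ni; have := e i; rewrite /conv ni subr0.
have := e i0; rewrite /conv eqxx big1 ?subr0 /=; last by move=> i /ne->; rewrite mulr0.
move/eqP; rewrite subr_eq0 -rmorphM -(rmorph1 f) => /eqP /f_inj /(congr1 red).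
by rewrite rmorphM (strict_red_unif st) mul0r rmorph1 => /esym/eqP; rewrite oner_eq0.
Qed.

Lemma elementary_contains M : M `<=` lin_span f b ->
  (forall c, M (\sum_i f (c i) *: b i) -> exists d, \sum_i w (l i) * c i = varpi * d) ->
  M `<=` lin_span f elementary_basis.
Proof.
move=> Mb Ml v Mv; have [c vE] := Mb v Mv; rewrite vE in Mv.
have [d dE] := Ml c Mv; exists (fun i => if i == i0 then d else c i); rewrite vE.
rewrite (unconvE (d := f d)).
  by apply: eq_bigr => i _; rewrite /unconv; case: eqP.
rewrite /pi -rmorphM -dE rmorph_sum; apply: eq_bigr => i _.
by rewrite rmorphM g2E.
Qed.

End ElementaryChange.

(** A Nakayama argument: surjectivity modulo [varpi] puts the span into [M + pi^m span] for every
    [m], and for [m = N] the second summand lies in [M]. *)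
Lemma span_of_reductions r (b : 'I_r -> V) M N : is_submod f M ->
  (forall i, M (pi ^+ N *: b i)) ->
  (forall c : 'I_r -> S, exists d, M (\sum_i f (d i) *: b i) /\
     forall i, red (c i) = red (d i)) ->
  lin_span f b `<=` M.
Proof.
move=> sM MN red_onto; have [_ MD MZ] := sM.
have approx m v : lin_span f b v ->
    exists c : 'I_r -> S, M (v - \sum_i f (c i) *: (pi ^+ m *: b i)).
  case=> c0 ->; elim: m => [|m [c Mc]].
    exists c0; under [X in _ - X]eq_bigr do rewrite expr0 scale1r.
    by rewrite subrr; have [] := sM.
  have [d [Md cd]] := red_onto c.
  have /choice [e eE] : forall i, exists e, c i - d i = varpi * e.
    by move=> i; apply/(strict_ker st); rewrite rmorphB cd subrr.
  exists e; have := MD _ _ Mc (MZ (varpi ^+ m) _ Md); congr M.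
  have -> : \sum_i f (c i) *: (pi ^+ m *: b i) =
      \sum_i f (e i) *: (pi ^+ m.+1 *: b i) + f (varpi ^+ m) *: \sum_i f (d i) *: b i.
    rewrite scaler_sumr -big_split; apply: eq_bigr => i _.
    rewrite /= !scalerA -scalerDl -[c i](subrK (d i)) eE rmorphD rmorphM rmorphXn.
    by rewrite -/pi exprS mulrDl mulrA [f (e i) * pi]mulrC [f (d i) * _]mulrC.
  by rewrite opprD addrA addrNK.
move=> v /(approx N) [c]; set u := \sum_i _ => Mvu.
rewrite -[v](subrK u); apply: MD => //; apply: (submod_sum _ sM) => i _.
exact: MZ.
Qed.

(** Induction on the bound [x]. Either [M] fills the reduction and is the whole span, or [b] is
    replaced by an elementary basis. A chain below the new span can be extended by the old span, so
    the bound drops. *)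
Lemma stable_descent x : forall r (b : 'I_r -> V) M N, full_basis b ->
  is_submod f M -> (forall v, M v -> M (tau v)) ->
  (forall i, M (pi ^+ N *: b i)) -> M `<=` lin_span f b ->
  length_le f x M (lin_span f b) ->
  exists L, is_form g2 j C L /\ base_change f L = M.
Proof.
elim/ltn_ind: x => x IH r b M N full sM Mtau MN Mb len.
have bC i : C (b i) by case: full.1 => -> _; exact: mem_lin_span.
have [red_onto|nred] := pselect (forall c : 'I_r -> S,
  exists d, M (\sum_i f (d i) *: b i) /\ forall i, red (c i) = red (d i)).
  exists (lin_span g2 b); split; first by exists r, b; split=> //; exact: full.1.
  rewrite (base_change_span g2E); apply/seteqP; split=> //.
  exact: span_of_reductions MN red_onto.
have [|i0 [l [li0 lM]]] := rational_hyperplane (fun i => (bC i).2) sM Mtau.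
  case/existsNP: nred => c cN; exists (red \o c) => d Md cd.
  by apply: cN; exists d.
set b' := elementary_basis b i0 l.
have sb : lin_span f b' `<=` lin_span f b by exact: elementary_sub.
have full' : full_basis b' by exact: elementary_full_basis.
have nb : ~ lin_span f b' (b i0) by exact: elementary_notin.
have Mb' : M `<=` lin_span f b' by exact: elementary_contains.
have chain c y : chain_in f c y M (lin_span f b') -> (y < x)%N.
  move=> Hc; have [/(_ _ (leqnn y)) [_ _ cb'] _] := Hc; have [cy cS] := Hc.
  apply: (len (fun i => if (i <= y)%N then c i else lin_span f b)).
  apply: chain_rcons => //.
  - by split=> // i /cy [? ? cb]; split=> //; exact: subset_trans cb sb.
  - exact: submod_lin_span.
  - exact: subset_trans cb' sb.
  - by move=> E; apply: nb; apply: cb'; rewrite E; exact: mem_lin_span.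
have x0 : (0 < x)%N.
  by apply: (chain (fun=> M)); split=> // i _; split.
apply: (IH x.-1 _ r b' M N) => //; first by rewrite prednK.
- move=> i; have [_ _ MZ] := sM; rewrite /b' /elementary_basis; case: eqP => _.
    by rewrite scalerA mulrC -scalerA; exact: MZ.
  rewrite scalerBr; apply: (submodB sM) => //.
  by rewrite scalerA mulrC -scalerA g2E; exact: MZ.
- by move=> c y /chain; rewrite -{1}(prednK x0).
Qed.

Lemma clear_family r (c : 'I_r -> K) : exists N, forall i, exists y, pi ^+ N * c i = f y.
Proof.
have /choice [N NE] := fun i => clearK (c i).
exists (\max_i N i)%N => i; have [y yE] := NE i.
exists (varpi ^+ (\max_i N i - N i) * y).
rewrite rmorphM rmorphXn -yE mulrA -exprD subnK //.
by have := @leq_bigmax _ N i.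
Qed.

Lemma clear_span r r' (a : 'I_r -> V) (b : 'I_r' -> V) :
  (forall i, lin_span idfun a (b i)) ->
  exists N, forall i, lin_span f a (pi ^+ N *: b i).
Proof.
move=> ab; have ex i : exists N, lin_span f a (pi ^+ N *: b i).
  have [c ->] := ab i; have [N /choice [y yE]] := clear_family c.
  by exists N, y; rewrite scaler_sumr; apply: eq_bigr => l _; rewrite scalerA yE.
have [N NE] := choice ex; exists (\max_i N i)%N => i.
have -> : (\max_i N i = \max_i N i - N i + N i)%N.
  by rewrite subnK //; have := @leq_bigmax _ N i.
have [_ _ Z] := submod_lin_span f a.
by rewrite exprD -scalerA -rmorphXn; exact: Z.
Qed.

Lemma scale_full_basis r (b : 'I_r -> V) e : e != 0 -> full_basis b ->
  full_basis (fun i => j e *: b i).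
Proof.
move=> e0 [[Cb free] N0b]; have je0 : j e != 0 by rewrite fmorph_eq0.
split; last first.
  move=> v /N0b [c ->]; exists (fun i => c i / j e).
  by apply: eq_bigr => i _; rewrite /= scalerA divfK.
split; last first.
  move=> c c0 i; have /free /(_ i) /eqP : \sum_i j (c i * e) *: b i = 0.
    by rewrite -[RHS]c0; apply: eq_bigr => l _; rewrite scalerA rmorphM.
  by rewrite mulf_eq0 (negPf e0) orbF => /eqP.
rewrite Cb; apply/seteqP; split=> v [c ->].
  exists (fun i => c i / e); apply: eq_bigr => i _.
  by rewrite scalerA fmorph_div divfK.
exists (fun i => c i * e); apply: eq_bigr => i _.
by rewrite scalerA rmorphM.
Qed.

(** * Sums of Frobenius translates and their stabilization *)

Definition orbit_sum n M : set V :=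
  [set v | exists y : 'I_n -> V, (forall i, M (y i)) /\ v = \sum_(i < n) iter i tau (y i)].

Let iter_tauD n u v : iter n tau (u + v) = iter n tau u + iter n tau v.
Proof. by elim: n => //= n ->. Qed.

Let iter_tau0 n : iter n tau 0 = 0.
Proof. by elim: n => //= n ->. Qed.

Lemma submod_orbit_sum n M : is_submod f M -> is_submod f (orbit_sum n M).
Proof.
move=> [M0 MD MZ]; split.
- by exists (fun=> 0); split=> //; rewrite big1.
- move=> _ _ [y [My ->]] [z [Mz ->]]; exists (fun i => y i + z i); split.
    by move=> i; exact: MD.
  by rewrite -big_split; apply: eq_bigr => i _; rewrite iter_tauD.
- move=> a _ [y [My ->]].
  (* A scalar is moved inside [iter i tau] by taking preimages under [s]; surjectivity of [s] enters
     here. *)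
  have ex (i : 'I_n) : exists b, forall v, iter i tau (f b *: v) = f a *: iter i tau v.
    elim: {i}(i : nat) a => [|i IH] a; first by exists a.
    have [a' <-] := s_surj a; have [b bE] := IH a'; exists b => v.
    by rewrite /= bE tauZ sKf.
  have [b bE] := choice ex; exists (fun i => f (b i) *: y i); split.
    by move=> i; exact: MZ.
  by rewrite scaler_sumr; apply: eq_bigr => i _; rewrite bE.
Qed.

Lemma orbit_sum_mono n M : M 0 -> orbit_sum n M `<=` orbit_sum n.+1 M.
Proof.
move=> M0 _ [y [My ->]].
exists (fun i => if unlift ord_max i is Some i' then y i' else 0); split.
  by move=> i; case: unlift.
rewrite big_ord_recr /= unlift_none iter_tau0 addr0; apply: eq_bigr => i _.
have -> : widen_ord (leqnSn n) i = lift ord_max i by apply: val_inj; rewrite /= /bump leqNgt ltn_ord.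
by rewrite liftK.
Qed.

Lemma orbit_sum_tau n M v : M 0 -> orbit_sum n M v -> orbit_sum n.+1 M (tau v).
Proof.
move=> M0 [y [My ->]].
exists (fun i => if unlift ord0 i is Some i' then y i' else 0); split.
  by move=> i; case: unlift.
rewrite big_ord_recl unlift_none add0r tau_sum; apply: eq_bigr => i _.
by rewrite liftK.
Qed.

Lemma sub_orbit_sum n M : M 0 -> (0 < n)%N -> M `<=` orbit_sum n M.
Proof.
move=> M0; case: n => // n _ v Mv; exists (fun i => if i == ord0 then v else 0); split.
  by move=> i; case: ifP.
by rewrite big_ord_recl /= big1 ?addr0 // => i _; rewrite iter_tau0.
Qed.

Lemma orbit_sum_sub n M P : is_submod f P -> (forall v, P v -> P (tau v)) ->
  M `<=` P -> orbit_sum n M `<=` P.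
Proof.
move=> sP Ptau MP _ [y [My ->]]; apply: (submod_sum _ sP) => i _.
by elim: (nat_of_ord i) => [|k' IH]; [exact/MP/My|exact: Ptau].
Qed.

(** The orbit sums increase inside [P], which has bounded length over [M], so two consecutive ones
    agree; their common value is [tau]-stable and therefore final. *)
Lemma orbit_sum_stationary x M P : is_submod f M -> is_submod f P ->
  (forall v, P v -> P (tau v)) -> M `<=` P -> length_le f x M P ->
  exists n0, (forall v, orbit_sum n0 M v -> orbit_sum n0 M (tau v)) /\
    forall n, (n0 <= n)%N -> orbit_sum n M = orbit_sum n0 M.
Proof.
move=> sM sP Ptau MP len; have M0 : M 0 by case: sM.
have [n0 n00 E] : exists2 n0, (0 < n0)%N & orbit_sum n0 M = orbit_sum n0.+1 M.
  apply: contrapT => H; suff : (x.+1 <= x)%N by rewrite ltnn.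
  (* Indices are shifted by one because the empty orbit sum is 0 and need not contain [M]. *)
  apply: (len (fun n => orbit_sum n.+1 M)); split=> i ix.
    split; [exact: submod_orbit_sum|exact: sub_orbit_sum|exact: orbit_sum_sub].
  by split; [exact: orbit_sum_mono|move=> E; apply: H; exists i.+1].
have stable v : orbit_sum n0 M v -> orbit_sum n0 M (tau v).
  by rewrite {2}E; exact: orbit_sum_tau.
exists n0; split=> // n n0n; apply/seteqP; split.
  by apply: orbit_sum_sub => //; [exact: submod_orbit_sum|exact: sub_orbit_sum].
elim: n n0n => [|n IH]; first by rewrite leqn0 => /eqP ->.
rewrite leq_eqVlt => /orP[/eqP-> //|]; rewrite ltnS => /IH H.
exact: subset_trans H (orbit_sum_mono M0).
Qed.

Lemma stable_lattice r (b : 'I_r -> V) M : full_basis b -> is_form f idfun N0 M ->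
  exists L, is_form g2 j C L /\
    exists n0, forall n, (n0 <= n)%N -> base_change f L = orbit_sum n M.
Proof.
move=> full [r' [a [[N0a _] ->]]].
have bN0 i : N0 (b i).
  by have [[Cb _] _] := full; suff [] : C (b i) by []; rewrite Cb; exact: mem_lin_span.
have [N' aN'] : exists N, forall i, lin_span f b (pi ^+ N *: a i).
  apply: clear_span => i; apply: full.2; rewrite N0a; exact: (mem_lin_span idfun).
(* Enlarging the lattice of [b] by [pi^(-N')] gives a [tau]-stable lattice that contains [M]. *)
pose b' i := j (f2 t ^- N') *: b i.
have jE : j (f2 t ^- N') = pi ^- N' by rewrite fmorphV rmorphXn jf2 g2t.
have full' : full_basis b'.
  apply: scale_full_basis full; rewrite invr_eq0 expf_neq0 //.
  by rewrite -(fmorph_eq0 j) jf2 g2t.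
have pN' : pi ^+ N' != 0 by rewrite expf_neq0.
have ab' : lin_span f a `<=` lin_span f b'.
  apply: lin_span_sub => [|i]; first exact: submod_lin_span.
  have [c cE] := aN' i; exists c.
  apply: (scalerI pN'); rewrite cE scaler_sumr; apply: eq_bigr => l _.
  by rewrite /b' jE !scalerA mulrC mulrA mulVf // mul1r.
have [N b'N] : exists N, forall i, lin_span f a (pi ^+ N *: b' i).
  apply: clear_span => i; rewrite /b'.
  have [_ _ Z] := submod_lin_span idfun a; apply: (Z (j (f2 t ^- N'))).
  by rewrite -N0a.
have sM := submod_lin_span f a.
have b'C i : C (b' i) by case: full'.1 => -> _; exact: mem_lin_span.
have stableP v : lin_span f b' v -> lin_span f b' (tau v).
  case=> c ->; exists (fun i => s (c i)); rewrite tau_sum; apply: eq_bigr => i _.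
  by rewrite tauZ sKf (b'C i).2.
have len : length_le f (N * r)%N (lin_span f a) (lin_span f b').
  apply: (length_le_sub (A := lin_span f (fun i => pi ^+ N *: b' i))
    (B := lin_span f b')) => //; last exact: (length_le_span_exp st).
  by apply: lin_span_sub => //; exact: b'N.
have [n0 [stable nE]] := orbit_sum_stationary sM (submod_lin_span f b') stableP ab' len.
have M0 : lin_span f a 0 by case: sM.
have aO : lin_span f a `<=` orbit_sum n0 (lin_span f a).
  by rewrite -(nE n0.+1) //; exact: sub_orbit_sum.
have [L [LC LE]] := stable_descent (N := N) full' (submod_orbit_sum n0 sM) stable
  (fun i => aO _ (b'N i)) (orbit_sum_sub (submod_lin_span f b') stableP ab')
  (length_le_sub aO (fun v => id) len).
by exists L; split=> //; exists n0 => n /nE ->.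
Qed.

(** * Vertex lattices and points *)

Variables (s1 : S -> S).
Variables (sK1 : {rmorphism K -> K}) (herm : V -> V -> K) (n : nat).
Hypothesis sK1f : forall a, sK1 (f a) = f (s1 a).
Hypothesis sK1_pi : sK1 (f varpi) = f varpi.
Hypothesis hermDl : forall u v x, herm (u + v) x = herm u x + herm v x.
Hypothesis hermZl : forall a v x, herm (a *: v) x = a * herm v x.
Hypothesis hermDr : forall u v x, herm x (u + v) = herm x u + herm x v.
Hypothesis hermZr : forall a v x, herm x (a *: v) = sK1 a * herm x v.
Hypothesis N0_submod : is_submod idfun N0.
Hypothesis N0_rank : forall r (b : 'I_r -> V), is_basis idfun N0 b -> r = n.

(** The notions of vertex lattices are repeated over abstract scalars, in a form that is convertible
    to the original one when specialized. *)
Definition latC L := is_form g2 j C L.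
Definition latk M := is_form f idfun N0 M.
Definition dualC L := dual g2 herm C L.
Definition dualk M := dual f herm N0 M.
Definition scaled i M := scale_set (f varpi ^+ i) M.
Definition vertexC i L :=
  [/\ latC L, scaled i.+1 (dualC L) `<=` L & L `<=` scaled i (dualC L)].
Definition vertexC_ge i x L := vertexC i L /\
  exists y, incl_length g2 y (scaled i.+1 (dualC L)) L /\ (x <= y)%N.
Definition stable_hull M := xget set0 [set L | latC L /\
  exists n0, forall l, (n0 <= l)%N -> base_change f L = orbit_sum l M].

Let hull := stable_hull.

Let herm0l x : herm 0 x = 0.
Proof. by rewrite -(scale0r (0 : V)) hermZl mul0r. Qed.

Let herm0r x : herm x 0 = 0.
Proof. by rewrite -(scale0r (0 : V)) hermZr rmorph0 mul0r. Qed.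

Let sK_pi : sK pi = pi.
Proof. by rewrite sKf s_t. Qed.

Let pi_exp_neq0 i : pi ^+ i != 0.
Proof. by rewrite expf_neq0. Qed.

Lemma C_submod : is_submod j C.
Proof.
have [Z D M] := N0_submod; split.
- by split.
- by move=> u v [Nu tu] [Nv tv]; split; [exact: D|rewrite tauD tu tv].
- by move=> a v [Nv tv]; split; [exact: M|rewrite tauZ tv sKj].
Qed.

Lemma C_scale i v : C v -> C (pi ^+ i *: v).
Proof.
by have [_ _ Z] := C_submod; rewrite -g2t -jf2 -rmorphXn; exact: Z.
Qed.

Lemma latC_sub L : latC L -> L `<=` C.
Proof.
case=> r [b [[Cb _] ->]]; have bC i : C (b i) by rewrite Cb; exact: mem_lin_span.
apply: lin_span_sub => //; have [? ? Z] := C_submod; split=> // a v.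
by rewrite -jf2; exact: Z.
Qed.

Lemma latC_submod L : latC L -> is_submod g2 L.
Proof. by case=> r [b [_ ->]]; exact: submod_lin_span. Qed.

Lemma latk_submod M : latk M -> is_submod f M.
Proof. by case=> r [b [_ ->]]; exact: submod_lin_span. Qed.

Lemma latC_tau L v : latC L -> base_change f L v -> base_change f L (tau v).
Proof.
move=> [r [b [[Cb _] ->]]]; rewrite (base_change_span g2E) => -[c ->].
exists (fun i => s (c i)); rewrite tau_sum; apply: eq_bigr => i _.
have [_ tb] : C (b i) by rewrite Cb; exact: mem_lin_span.
by rewrite tauZ sKf tb.
Qed.

Lemma dualk_submod M : is_submod f (dualk M).
Proof.
have [Z D MM] := N0_submod; split.
- by split=> // x _; exists 0; rewrite herm0l rmorph0.
- move=> u v [Nu Hu] [Nv Hv]; split; first exact: D.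
  move=> x Mx; have [a aE] := Hu x Mx; have [b bE] := Hv x Mx.
  by exists (a + b); rewrite hermDl aE bE rmorphD.
- move=> a v [Nv Hv]; split; first exact: MM.
  by move=> x Mx; have [b bE] := Hv x Mx; exists (a * b); rewrite hermZl bE rmorphM.
Qed.

Lemma dualC_submod L : is_submod g2 (dualC L).
Proof.
have [Z D MM] := C_submod; split.
- by split=> // x _; exists 0; rewrite herm0l rmorph0.
- move=> u v [Nu Hu] [Nv Hv]; split; first exact: D.
  move=> x Mx; have [a aE] := Hu x Mx; have [b bE] := Hv x Mx.
  by exists (a + b); rewrite hermDl aE bE rmorphD.
- move=> a v [Nv Hv]; split; first by rewrite -jf2; exact: MM.
  by move=> x Mx; have [b bE] := Hv x Mx; exists (a * b); rewrite hermZl bE rmorphM.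
Qed.

Lemma dualk_anti M P : M `<=` P -> dualk P `<=` dualk M.
Proof. by move=> MP v [Nv H]; split=> // x /MP; exact: H. Qed.

Lemma dualC_anti L L' : L `<=` L' -> dualC L' `<=` dualC L.
Proof. by move=> LL v [Nv H]; split=> // x /LL; exact: H. Qed.

Lemma dualC_dualk L : dualC L `<=` dualk (base_change f L).
Proof.
move=> v [[Nv tv] H]; split=> //.
suff: base_change f L `<=` [set x | exists a, herm v x = f a] by [].
apply: base_change_sub.
  split.
  - by exists 0; rewrite herm0r rmorph0.
  - by move=> x y [a aE] [b bE]; exists (a + b); rewrite hermDr aE bE rmorphD.
  - by move=> a x [b bE]; exists (s1 a * b); rewrite hermZr bE rmorphM sK1f.
by move=> x /H [a aE]; exists (w a); rewrite aE g2E.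
Qed.

Lemma scaled_comp i i' M v : scaled i M v -> scaled (i' + i) M (pi ^+ i' *: v).
Proof. by case=> x Mx <-; exists x => //; rewrite scalerA -exprD. Qed.

(** Available before [C] is known to span: a hull that is a lattice cannot be the default value
    [set0], which does not contain 0. *)
Lemma stable_hull_cover M : latk M -> latC (hull M) -> M `<=` base_change f (hull M).
Proof.
move=> Mk; rewrite /hull /stable_hull; case: xgetP => [L _ [_ [n0 E]] _|_].
  by rewrite (E n0.+1) //; apply: sub_orbit_sum => //; case: (latk_submod Mk).
by move/latC_submod => [].
Qed.

(** * Hulls, duality and types once the hermitian space spans *)

Section WithFullBasis.
Variables (r : nat) (b : 'I_r -> V).
Hypothesis full : full_basis b.

Lemma hullP M : latk M -> latC (hull M) /\
  exists n0, forall l, (n0 <= l)%N -> base_change f (hull M) = orbit_sum l M.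
Proof.
move=> Mk; have [L LP] := stable_lattice full Mk.
by rewrite /hull /stable_hull; case: xgetP => [L' -> //|/(_ L)].
Qed.

Lemma sub_hull M : latk M -> M `<=` base_change f (hull M).
Proof.
move=> Mk; have [_ [n0 E]] := hullP Mk; rewrite (E n0.+1) //.
by apply: sub_orbit_sum => //; case: (latk_submod Mk).
Qed.

Lemma hull_min M P : latk M -> is_submod f P -> (forall v, P v -> P (tau v)) ->
  M `<=` P -> base_change f (hull M) `<=` P.
Proof.
move=> Mk sP Pt MP; have [_ [n0 E]] := hullP Mk; rewrite (E n0) //.
exact: orbit_sum_sub.
Qed.

Lemma capC L v : latC L -> base_change f L v -> C v -> L v.
Proof. exact: base_change_cap. Qed.

Lemma hull_sub M L : latk M -> latC L -> M `<=` base_change f L -> hull M `<=` L.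
Proof.
move=> Mk LC ML v hv; have [hC _] := hullP Mk; apply: capC => //.
  suff : base_change f (hull M) `<=` base_change f L by apply; exact: sub_base_change.
  apply: hull_min => //; first exact: submod_base_change.
  by move=> u; exact: latC_tau.
exact: (latC_sub hC).
Qed.

Lemma hull_mono M P : latk M -> latk P -> M `<=` P -> hull M `<=` hull P.
Proof.
move=> Mk Pk MP; apply: hull_sub => //; first by case: (hullP Pk).
exact: subset_trans MP (sub_hull Pk).
Qed.

Lemma hull_scale M P : latk M -> latk P -> scaled 1 M `<=` P ->
  forall v, hull M v -> hull P (pi *: v).
Proof.
move=> Mk Pk MP v hv; have [hM _] := hullP Mk; have [hP _] := hullP Pk.
apply: capC => //; last by rewrite -[pi]expr1; apply/C_scale/(latC_sub hM).
have [Z D MM] := submod_base_change f (hull P).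
pose Pi : set V := [set u | base_change f (hull P) (pi *: u)].
suff : base_change f (hull M) `<=` Pi by apply; exact: sub_base_change.
apply: hull_min => //.
- split=> [|x y|a x]; rewrite /Pi /= ?scaler0 ?scalerDr //; first exact: D.
  by move=> /(MM a); rewrite !scalerA mulrC.
- by move=> u; rewrite /Pi /= -{2}sK_pi -tauZ; exact: latC_tau.
by move=> u Mu; apply/sub_hull/MP => //; exists u; rewrite ?expr1.
Qed.

(** The hull contains [M], so its dual lies in the dual of [M]; intersecting with [C] then
    transports the inclusion to the hulls. *)
Lemma dualC_hull i M P : latk M -> latk P -> scaled i (dualk M) `<=` P ->
  scaled i (dualC (hull M)) `<=` hull P.
Proof.
move=> Mk Pk MP v vS; have [hM _] := hullP Mk; have [hP _] := hullP Pk.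
have sub : scaled i (dualC (hull M)) `<=` scaled i (dualk M).
  apply: scale_set_sub => u /dualC_dualk; exact/dualk_anti/sub_hull.
apply: capC => //; first by apply/sub_hull/MP/sub.
by case: vS => u [Cu _] <-; exact: C_scale.
Qed.

Lemma base_change_dual_hull i M : latk M ->
  base_change f (scaled i (dualC (hull M))) `<=` scaled i (dualk M).
Proof.
move=> Mk; apply: base_change_sub; first exact/submod_scale_set/dualk_submod.
apply: scale_set_sub => u /dualC_dualk; exact/dualk_anti/sub_hull.
Qed.

(** The type counts the steps of a composition series over [S2], and this number bounds chains over
    [S] after base change. The series exists because [t L] lies in [pi^(i+1)] times the dual, so
    that its length is at most that of [L / t L]. *)
Lemma vertexC_geP i x L : vertexC i L ->
  (forall y, length_le f y (base_change f (scaled i.+1 (dualC L))) (base_change f L) ->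
    (x <= y)%N) -> vertexC_ge i x L.
Proof.
move=> vL H; split=> //; have [LC le1 le2] := vL.
have sD : is_submod g2 (scaled i.+1 (dualC L)).
  exact/submod_scale_set/dualC_submod.
have step v : L v -> scaled i.+1 (dualC L) (g2 t *: v).
  by move=> /le2 /(scaled_comp 1); rewrite expr1 g2t.
have [y Hy] : exists y, incl_length g2 y (scaled i.+1 (dualC L)) L.
  have [r' [b' [_ LE]]] := LC.
  apply: (incl_length_exists st2 sD (latC_submod LC) le1 step (x := r')).
  apply: (length_le_sub (A := lin_span g2 (fun l => g2 t *: b' l))
    (B := lin_span g2 b')); last exact: (length_le_span st2).
    by apply: lin_span_sub => // l; apply: step; rewrite LE; exact: mem_lin_span.
  by rewrite LE.
exists y; split=> //; apply: H.
have stw : strict_ring (w t) red by rewrite wt.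
exact: (length_le_base_change g2E stw step).
Qed.

Variables (m : nat) (h : nat -> nat) (A B : nat -> set V).
Hypothesis m_gt0 : (0 < m)%N.
Hypothesis AB_lattice : forall i, (1 <= i <= m)%N -> latk (A i) /\ latk (B i).
Hypothesis A_chain : forall i, (1 <= i < m)%N -> A i.+1 `<=` A i.
Hypothesis B_chain : forall i, (1 <= i < m)%N -> B i `<=` B i.+1.
Hypothesis dualA : forall i, (1 <= i <= m)%N ->
  [/\ scaled 1 (dualk (A i)) `<=` B i, incl_length f 1 (scaled 1 (dualk (A i))) (B i) &
      B i `<=` dualk (A i)].
Hypothesis dualB : forall i, (1 <= i <= m)%N ->
  [/\ scaled 1 (dualk (B i)) `<=` A i, incl_length f 1 (scaled 1 (dualk (B i))) (A i) &
      A i `<=` dualk (B i)].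
Hypothesis AB_length : forall i, (1 <= i <= m)%N ->
  [/\ scaled 1 (B i) `<=` A i, A i `<=` B i & incl_length f (h i) (A i) (B i)].

Let HA i := hull (A i).
Let HB i := hull (B i).

Definition type_mem i :=
  [\/ i = 0%N /\ vertexC 1 (HA 1%N), i = m /\ vertexC 0 (HB m) |
      (1 <= i < m)%N /\ HB i `<=` scaled 1 (dualC (HA i.+1))].

Let B_mono i l : (1 <= i)%N -> (i <= l)%N -> (l <= m)%N -> B i `<=` B l.
Proof.
move=> i1; elim: l => [|l IH] il lm; first by move: il; rewrite leqn0 => /eqP->.
move: il; rewrite leq_eqVlt => /orP[/eqP-> //|il] v /(IH il (ltnW lm)).
by apply: B_chain; rewrite (leq_trans i1).
Qed.

Lemma scaledS i : scaled i.+1 = scaled 1 \o scaled i.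
Proof.
apply/funext => M; apply/seteqP; split=> v.
  by case=> x Mx <-; exists (pi ^+ i *: x); [exists x|rewrite scalerA -exprD].
by case=> _ [x Mx <-] <-; exists x; rewrite // scalerA -exprD.
Qed.

Lemma hullA_lower i : (1 <= i <= m)%N -> scaled 2 (dualC (HA i)) `<=` HA i.
Proof.
move=> im; have [Ak Bk] := AB_lattice im; apply: dualC_hull => //.
have [d _ _] := dualA im; have [BA _ _] := AB_length im.
rewrite scaledS; apply: subset_trans BA; exact: scale_set_sub.
Qed.

Lemma hullB_lower i : (1 <= i <= m)%N -> scaled 1 (dualC (HB i)) `<=` HB i.
Proof.
move=> im; have [Ak Bk] := AB_lattice im; apply: dualC_hull => //.
by have [d _ _] := dualB im; have [_ AB _] := AB_length im; exact: subset_trans d AB.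
Qed.

(** From [pi B_i <= pi B_(i+1) <= A_(i+1)] one gets [pi HB i <= HA i.+1]. For [v = pi u] and [x] in
    [HB i], with [u] in the dual of [HA i.+1], the value [{v, x} = {u, pi x}] is therefore integral.
    The vertex condition on [HA i.+1] follows from [HA i.+1 <= HB i]. *)
Let cross i : (1 <= i < m)%N -> HB i `<=` scaled 1 (dualC (HA i.+1)) ->
  [/\ vertexC 0 (HB i) & vertexC 1 (HA i.+1)].
Proof.
case/andP=> i1 im sub.
have im' : (1 <= i <= m)%N by rewrite i1 ltnW.
have im1 : (1 <= i.+1 <= m)%N by [].
have [Ak Bk] := AB_lattice im'; have [Ak1 Bk1] := AB_lattice im1.
have [hBC _] := hullP Bk; have [hAC _] := hullP Ak1.
have [BA1 _ _] := AB_length im1; have [_ AB _] := AB_length im'.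
have Bsub : B i `<=` B i.+1 by apply: B_chain; rewrite i1.
have Asub : A i.+1 `<=` A i by apply: A_chain; rewrite i1.
have piB v : HB i v -> HA i.+1 (pi *: v).
  apply: hull_scale => //; apply: subset_trans BA1; exact: scale_set_sub.
split; split=> //.
- exact: hullB_lower.
- move=> v Bv; exists v; last by rewrite expr0 scale1r.
  have /sub [u [Cu Hu] uv] := Bv; split; first exact: (latC_sub hBC).
  move=> x Bx; have [a aE] := Hu _ (piB x Bx); exists a.
  by rewrite -uv -aE hermZl expr1 hermZr sK1_pi.
- exact: hullA_lower.
apply: subset_trans sub; apply: hull_mono => //.
exact: subset_trans Asub AB.
Qed.

Lemma type_vertex_B i : type_mem i -> i <> 0%N -> vertexC 0 (HB i).
Proof. by case=> [[-> _]//|[-> //]|[im /(cross im)[]]]. Qed.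

Lemma type_vertex_A i : type_mem i -> i <> m -> vertexC 1 (HA i.+1).
Proof. by case=> [[-> //]|[-> _]//|[im /(cross im)[]]]. Qed.

Lemma type_le i : type_mem i -> (i <= m)%N.
Proof. by case=> [[-> _]//|[-> //]|[/andP[_ /ltnW]]]. Qed.

(** In [pi HB^dual <= pi B^dual < A <= B <= HB] the middle inclusions have lengths 1 and [h i]. *)
Lemma type_vertex_ge_B i : type_mem i -> i <> 0%N -> vertexC_ge 0 (h i).+1 (HB i).
Proof.
move=> ti i0; have im : (1 <= i <= m)%N by rewrite type_le // andbT lt0n; apply/eqP.
have [Ak Bk] := AB_lattice im.
apply: vertexC_geP; first exact: type_vertex_B.
move=> y len; have [_ l1 _] := dualB im; have [_ AB lh] := AB_length im.
have [c1 ch1] := incl_length_chain l1; have [c2 ch2] := incl_length_chain lh.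
have [d01 _ _] := dualB im.
have [e] := chain_cat d01 AB (fun v => id) ch1 ch2.
have len' : length_le f y (scaled 1 (dualk (B i))) (B i).
  by apply: length_le_sub len; [exact: base_change_dual_hull|exact: sub_hull].
by rewrite add1n; exact: len'.
Qed.

Let scaled1_span r' (b' : 'I_r' -> V) :
  scaled 1 (lin_span f b') = lin_span f (fun l => pi *: b' l).
Proof.
apply/seteqP; split=> v.
  case=> _ [c ->] <-; exists c; rewrite scaler_sumr expr1; apply: eq_bigr => l _.
  by rewrite !scalerA mulrC.
case=> c ->; exists (\sum_l f (c l) *: b' l); first by exists c.
rewrite scaler_sumr expr1; apply: eq_bigr => l _.
by rewrite !scalerA mulrC.
Qed.

Lemma scaled_length M : latk M -> length_le f n (scaled 1 M) M.
Proof.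
move=> [r' [b' [bas ->]]]; rewrite -(N0_rank bas) scaled1_span.
exact: (length_le_span st).
Qed.

Lemma scaled_chain M : latk M -> exists c, chain_in f c n (scaled 1 M) M.
Proof.
move=> [r' [b' [bas ->]]]; rewrite -(N0_rank bas) scaled1_span.
apply: (chain_span st) => c c0 l; apply: f_inj; rewrite rmorph0.
exact: (bas.2 (f \o c)).
Qed.

(** In [pi^2 HA^dual <= pi^2 A^dual < pi B <= A <= HA] the strict step counts 1. The length of
    [A / pi B] is at least [n - h i.+1], since [B / pi B] has length [n] and [B / A] has length
    [h i.+1]. *)
Lemma type_vertex_ge_A i : type_mem i -> i <> m ->
  vertexC_ge 1 (n - h i.+1).+1 (HA i.+1).
Proof.
move=> ti ni.
have im : (1 <= i.+1 <= m)%N by rewrite /= ltn_neqAle type_le // andbT; apply/eqP.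
have [Ak Bk] := AB_lattice im.
apply: vertexC_geP; first exact: type_vertex_A.
move=> y len; have [d01 l1 _] := dualA im; have [BA AB lh] := AB_length im.
have sB := latk_submod Bk; have sA := latk_submod Ak.
have sB1 : is_submod f (scaled 1 (B i.+1)) by exact: submod_scale_set.
have s2 : scaled 2 (dualk (A i.+1)) = scaled 1 (scaled 1 (dualk (A i.+1))).
  by rewrite (scaledS 1).
have sub2 : scaled 2 (dualk (A i.+1)) `<=` scaled 1 (B i.+1).
  by rewrite s2; exact: scale_set_sub.
have ne2 : scaled 2 (dualk (A i.+1)) <> scaled 1 (B i.+1).
  rewrite s2 => /(scale_set_inj (pi_exp_neq0 1)); exact: incl_length1_neq l1.
have sD : is_submod f (scaled 2 (dualk (A i.+1))).
  exact/submod_scale_set/dualk_submod.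
have [z lz] : exists z, incl_length f z (scaled 1 (B i.+1)) (A i.+1).
  apply: (incl_length_exists st sB1 sA BA) => [v /AB Bv|]; first by exists v; rewrite ?expr1.
  exact: length_le_sub (fun v => id) AB (scaled_length Bk).
have nz : (n <= z + h i.+1)%N.
  have len2 := length_le_trans sA sB BA AB (incl_length_le lz) (incl_length_le lh).
  by have [c] := scaled_chain Bk; exact: len2.
have [c1 ch1] := chain_one sD sB1 sub2 ne2; have [c2 ch2] := incl_length_chain lz.
have [e che] := chain_cat sub2 BA (fun v => id) ch1 ch2.
have len' : length_le f y (scaled 2 (dualk (A i.+1))) (A i.+1).
  by apply: length_le_sub len; [exact: base_change_dual_hull|exact: sub_hull].
by apply: leq_trans (len' _ _ che); rewrite add1n ltnS leq_subLR addnC.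
Qed.

(** Here [A 1 = B 1], and membership would give [A 1 <= pi (A 1)^dual], whereas [pi (A 1)^dual] is
    strictly contained in [B 1]. *)
Lemma type_not0 : h 1%N = 0%N -> ~ type_mem 0.
Proof.
move=> h1 t0; have m1 : (1 <= 1 <= m)%N by [].
have m0 : 0%N <> m by move=> E; move: m_gt0; rewrite -E.
have [_ _ le2] := type_vertex_A t0 m0.
have [d01 l1 _] := dualA m1; have [_ _ lh] := AB_length m1.
have [Ak Bk] := AB_lattice m1.
have AB : A 1%N = B 1%N by move: lh; rewrite h1 => -[c [<- <-]].
apply: (incl_length1_neq l1); apply/seteqP; split=> // v; rewrite -AB => /(sub_hull Ak).
suff : base_change f (HA 1%N) `<=` scaled 1 (dualk (A 1%N)) by apply.
apply: base_change_sub; first exact/submod_scale_set/dualk_submod.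
apply: subset_trans le2 _; apply: scale_set_sub => u /dualC_dualk.
exact/dualk_anti/sub_hull.
Qed.

(** Comparing lengths gives [A m = pi B m]. Membership would give [B m <= (B m)^dual], so that [A m]
    would equal [pi (B m)^dual], in which it has index of length 1. *)
Lemma type_notm : h m = n -> ~ type_mem m.
Proof.
move=> hm tm; have mm : (1 <= m <= m)%N by rewrite m_gt0 leqnn.
have m0 : m <> 0%N by move=> E; move: m_gt0; rewrite E.
have [_ _ le2] := type_vertex_B tm m0.
have [d01 l1 _] := dualB mm; have [BA AB lh] := AB_length mm.
have [Ak Bk] := AB_lattice mm.
have sB := latk_submod Bk; have sA := latk_submod Ak.
have sB1 : is_submod f (scaled 1 (B m)) by exact: submod_scale_set.
have AE : scaled 1 (B m) = A m.
  apply: contrapT => ne; have [c1 ch1] := chain_one sB1 sA BA ne.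
  have [c2 ch2] := incl_length_chain lh.
  have [e che] := chain_cat BA AB (fun v => id) ch1 ch2.
  have lenB := scaled_length Bk; have : (1 + h m <= n)%N by exact: (lenB _ _ che).
  by rewrite hm add1n ltnn.
apply: (incl_length1_neq l1); rewrite -AE; congr (scaled 1 _); apply/seteqP; split.
  by move: d01; rewrite -AE => d01 v Dv; have [|u Bu] := d01 (pi ^+ 1 *: v);
    [exists v|move=> /(scalerI (pi_exp_neq0 1)) <-].
move=> v /(sub_hull Bk).
suff : base_change f (HB m) `<=` dualk (B m) by apply.
apply: base_change_sub; first exact: dualk_submod.
apply: subset_trans le2 _ => _ [u Du <-]; rewrite expr0 scale1r.
by apply: dualk_anti (dualC_dualk Du); exact: sub_hull.
Qed.

(** [pi (A i.+1)^dual <= B i.+1 <= B l], and such inclusions pass to the hulls. *)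
Lemma type_next i l : (i < l)%N -> (l <= m)%N -> scaled 1 (dualC (HA i.+1)) `<=` HB l.
Proof.
move=> il lm; have i1 : (1 <= i.+1 <= m)%N by rewrite /= (leq_trans il).
have l1 : (1 <= l <= m)%N by rewrite lm andbT (leq_trans _ il).
have [Ak _] := AB_lattice i1; have [_ Bk] := AB_lattice l1.
have [d _ _] := dualA i1; apply: dualC_hull => //.
by apply: subset_trans d _; exact: B_mono.
Qed.

(** * Comparison with an arbitrary stratum containing the point *)

Section Stratum.
Variables (I : set nat) (M0 M1 : nat -> set V).
Hypothesis I_le : forall i, I i -> (i <= m)%N.
Hypothesis M0_vertex : forall i, I i -> i <> 0%N -> vertexC 0 (M0 i).
Hypothesis M1_vertex : forall i, I i -> i <> m -> vertexC 1 (M1 i).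
Hypothesis M_same : forall i, I i -> i <> 0%N -> i <> m -> M0 i `<=` scaled 1 (dualC (M1 i)).
Hypothesis in_M0 : forall i, I i -> i <> 0%N -> B i `<=` base_change f (M0 i).
Hypothesis in_M1 : forall i, I i -> i <> m -> A i.+1 `<=` base_change f (M1 i).

Lemma stratum_B i : I i -> i <> 0%N -> HB i `<=` M0 i.
Proof.
move=> Ii i0; have im : (1 <= i <= m)%N by rewrite I_le // andbT lt0n; apply/eqP.
have [_ Bk] := AB_lattice im; have [MC _ _] := M0_vertex Ii i0.
by apply: hull_sub => //; exact: in_M0.
Qed.

Lemma stratum_A i : I i -> i <> m -> HA i.+1 `<=` M1 i.
Proof.
move=> Ii ni; have im : (1 <= i.+1 <= m)%N by rewrite /= ltn_neqAle I_le // andbT; apply/eqP.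
have [Ak _] := AB_lattice im; have [MC _ _] := M1_vertex Ii ni.
by apply: hull_sub => //; exact: in_M1.
Qed.

(** The hulls are contained in the lattices of the index and their duals are larger, so every
    inclusion that defines the type is inherited from the index. *)
Lemma stratum_type i : I i -> type_mem i.
Proof.
move=> Ii; have [i0|/eqP i0] := eqVneq i 0%N.
  have ni : i <> m by move=> im; move: m_gt0; rewrite -im i0.
  have sub := stratum_A Ii ni; have [_ _ le2] := M1_vertex Ii ni.
  move: sub le2; rewrite i0 => sub le2.
  constructor 1; split=> //; have m1 : (1 <= 1 <= m)%N by [].
  have [Ak _] := AB_lattice m1; split; [by case: (hullP Ak)|exact: hullA_lower|].
  apply: subset_trans sub _; apply: subset_trans le2 _.
  by apply: scale_set_sub; apply: dualC_anti; rewrite -i0; exact: stratum_A.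
have [im|/eqP ni] := eqVneq i m.
  have sub := stratum_B Ii i0; have [_ _ le2] := M0_vertex Ii i0.
  move: sub le2; rewrite im => sub le2.
  constructor 2; split=> //; have mm : (1 <= m <= m)%N by rewrite m_gt0 leqnn.
  have [_ Bk] := AB_lattice mm; split; [by case: (hullP Bk)|exact: hullB_lower|].
  apply: subset_trans sub _; apply: subset_trans le2 _.
  by apply: scale_set_sub; apply: dualC_anti; rewrite -im; exact: stratum_B.
constructor 3; split.
  by apply/andP; split; [rewrite lt0n; apply/eqP|
    rewrite ltn_neqAle I_le // andbT; apply/eqP].
apply: subset_trans (stratum_B Ii i0) _; apply: subset_trans (M_same Ii i0 ni) _.
by apply: scale_set_sub; apply: dualC_anti; exact: stratum_A.
Qed.

End Stratum.

Lemma point_strata :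
  [/\ [/\ (forall i, type_mem i -> (i <= m)%N), (h 1%N = 0%N -> ~ type_mem 0) &
      (h m = n -> ~ type_mem m)],
   [/\ (forall i, type_mem i -> i <> 0%N -> vertexC_ge 0 (h i).+1 (HB i)),
      (forall i, type_mem i -> i <> m -> vertexC_ge 1 (n - h i.+1).+1 (HA i.+1)) &
      (forall i, type_mem i -> i <> 0%N -> i <> m ->
         HB i `<=` scaled 1 (dualC (HA i.+1)))],
   [/\ (forall i l, (i < l)%N -> (l <= m)%N -> scaled 1 (dualC (HA i.+1)) `<=` HB l),
      (forall i, (1 <= i <= m)%N -> B i `<=` base_change f (HB i)) &
      (forall i, (1 <= i <= m)%N -> A i `<=` base_change f (HA i))] &
   forall (I : set nat) (M0 M1 : nat -> set V),
     (forall i, I i -> (i <= m)%N) ->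
     (forall i, I i -> i <> 0%N -> vertexC 0 (M0 i)) ->
     (forall i, I i -> i <> m -> vertexC 1 (M1 i)) ->
     (forall i, I i -> i <> 0%N -> i <> m -> M0 i `<=` scaled 1 (dualC (M1 i))) ->
     (forall i, I i -> i <> 0%N -> B i `<=` base_change f (M0 i)) ->
     (forall i, I i -> i <> m -> A i.+1 `<=` base_change f (M1 i)) ->
     [/\ I `<=` type_mem,
       (forall i, I i -> i <> 0%N -> HB i `<=` M0 i) &
       (forall i, I i -> i <> m -> HA i.+1 `<=` M1 i)]].
Proof.
split; [split|split|split|].
- exact: type_le.
- exact: type_not0.
- exact: type_notm.
- exact: type_vertex_ge_B.
- exact: type_vertex_ge_A.
- by move=> i [[-> _]|[-> _]|[_ //]].
- exact: type_next.
- by move=> i /AB_lattice [_ Bk]; exact: sub_hull.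
- by move=> i /AB_lattice [Ak _]; exact: sub_hull.
move=> I M0 M1 Im v0 v1 M01 B0 A1; split.
- by move=> i; exact: (stratum_type Im v0 v1 M01 B0 A1).
- exact: stratum_B.
- exact: stratum_A.
Qed.

End WithFullBasis.

End SemilinearDescent.

(** * The hermitian form *)

Section Operators.
Variables (K : fieldType) (V : vectType K) (s : {rmorphism K -> K}) (c d : K).
Variables (F : {additive V -> V}) (pair : V -> V -> K).
Hypotheses (c_neq0 : c != 0) (s_c : s c = c).
Hypothesis F_semilinear : forall a v, F (a *: v) = s a *: F v.
Hypothesis pair_linear_l : forall a u v w, pair (a *: u + v) w = a * pair u w + pair v w.
Hypothesis pair_linear_r : forall a u v w, pair w (a *: u + v) = a * pair w u + pair w v.

(** The operator [tau], with [c^-1 F] in place of the inverse of [V]. *)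
Definition slope0_op (v : V) : V := c *: (c^-1 *: F (c^-1 *: F v)).

Definition sesqui (v w : V) : K := d * pair v (F w).

Lemma slope0_opE v : slope0_op v = c^-1 *: F (F v).
Proof.
rewrite /slope0_op scalerA divff ?scale1r //.
by rewrite F_semilinear fmorphV s_c.
Qed.

Lemma slope0_opD v w : slope0_op (v + w) = slope0_op v + slope0_op w.
Proof. by rewrite !slope0_opE !raddfD. Qed.

Lemma slope0_opZ a v : slope0_op (a *: v) = (s \o s) a *: slope0_op v.
Proof. by rewrite !slope0_opE !F_semilinear !scalerA mulrC. Qed.

Let pairDr u v w : pair w (u + v) = pair w u + pair w v.
Proof. by have := pair_linear_r 1 u v w; rewrite scale1r mul1r. Qed.

Let pair0r w : pair w 0 = 0.
Proof. by apply: (addrI (pair w 0)); rewrite -pairDr !addr0. Qed.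

Let pairZr a v w : pair w (a *: v) = a * pair w v.
Proof. by have := pair_linear_r a v 0 w; rewrite !addr0 pair0r addr0. Qed.

Let pairDl u v w : pair (u + v) w = pair u w + pair v w.
Proof. by have := pair_linear_l 1 u v w; rewrite scale1r mul1r. Qed.

Let pair0l w : pair 0 w = 0.
Proof. by apply: (addrI (pair 0 w)); rewrite -pairDl !addr0. Qed.

Let pairZl a v w : pair (a *: v) w = a * pair v w.
Proof. by have := pair_linear_l a v 0 w; rewrite !addr0 pair0l addr0. Qed.

Lemma sesquiDl u v w : sesqui (u + v) w = sesqui u w + sesqui v w.
Proof. by rewrite /sesqui pairDl mulrDr. Qed.

Lemma sesquiZl a v w : sesqui (a *: v) w = a * sesqui v w.
Proof. by rewrite /sesqui pairZl mulrCA. Qed.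

Lemma sesquiDr u v w : sesqui w (u + v) = sesqui w u + sesqui w v.
Proof. by rewrite /sesqui raddfD pairDr mulrDr. Qed.

Lemma sesquiZr a v w : sesqui w (a *: v) = s a * sesqui w v.
Proof. by rewrite /sesqui F_semilinear pairZr mulrCA. Qed.

Lemma eigen_submod (A : Type) (act : A -> {linear V -> V}) (x : A -> K) :
  is_submod idfun [set v | forall a, act a v = x a *: v].
Proof.
split=> [a|v w Nv Nw a|e v Nv a]; first by rewrite linear0 scaler0.
  by rewrite linearD Nv Nw scalerDr.
by rewrite linearZ /= Nv !scalerA mulrC.
Qed.

End Operators.

(** * Strata of the moduli space *)

(* [exact_no_check] leaves to the kernel the conversions between projections of
   [base_data] and [isocrystal], on which unification is prohibitively slow. *)
Section Strata.
Variables (p : nat) (D : base_data p) (n m : nat) (h : nat -> nat) (N : isocrystal D n).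
Hypotheses (p_prime : prime p) (p_odd : odd p) (n_gt0 : (0 < n)%N) (m_gt0 : (0 < m)%N).
Variables (A B : nat -> set N).
Hypothesis AB : is_point m h A B.

Let tauN := @slope0_op (Fk D) (Nk N) (bpi D) (Fr N).
Let hermN := @sesqui (Fk D) (Nk N) (iq2 (delta D)) (Fr N) (@pairing p D n N).

Lemma full_basis_exists (L M : set N) : is_lattice_C L -> is_lattice_k M ->
  M `<=` lattice_k L ->
  exists r (b : 'I_r -> N), full_basis (frac_map D) tauN (Nk0 N) b.
Proof.
case=> r [b [bas ->]] Mk ML; exists r, b.
unshelve epose proof (@full_basis_of_cover (Wq2 D) (Wk D) (Fq2 D) (Fk D) (witt_map D)
  (@ik p D) (frac_map D) (@iq2 p D) (@iq2E p D) (Nk N) tauN (Nk0 N) r b M _ _ _) as H.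
- exact_no_check bas.
- exact_no_check Mk.
- exact_no_check ML.
- exact_no_check H.
Qed.

Let tauZ := @slope0_opZ (Fk D) (Nk N) (sigma D) (bpi D) (Fr N) (bpi_neq0 D)
  (sigma_bpi D) (@Fr_semilinear _ _ _ N).

Lemma bt_lattice_cover (M : set N) : is_lattice_k M -> is_lattice_C (bt_lattice M) ->
  M `<=` lattice_k (bt_lattice M).
Proof.
move=> Mk LC.
unshelve epose proof (@stable_hull_cover (Wq2 D) (Wk D) (Fq2 D) (Fk D) (@ik p D)
  (frac_map D) (@iq2 p D) (sigma D \o sigma D) (Nk N) tauN (Nk0 N) _ M _ _) as H.
- exact_no_check tauZ.
- exact_no_check Mk.
- exact_no_check LC.
exact_no_check H.
Qed.

Section FullBasis.
Variables (r : nat) (b : 'I_r -> N).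
Hypothesis full : full_basis (frac_map D) tauN (Nk0 N) b.

Let scalars_fixed a : sigma D (sigma D (frac_map D a)) = frac_map D a.
Proof.
have m1 : (1 <= 1 <= m)%N by [].
have [[r' [a' [bas _]]] _] := point_lattice AB m1.
have r'0 : (0 < r')%N by rewrite (Nk0_basis_size p_prime p_odd bas).
exact_no_check (@fixed_scalars (Fq2 D) (Fk D) (frac_map D) _ (Nk N) tauN (Nk0 N)
  tauZ r b r' a' r'0 bas full a).
Qed.

Let fixk (x : bk D) : x ^+ (#|resF D| * #|resF D|) = x ->
  exists a, x = witt_red (Wk D) (witt_map D a).
Proof.
move=> /frob2_fixed [e ->]; have [a <-] := strict_surj (strict_Wq2 D) e.
by exists a; rewrite witt_map_red.
Qed.

Let T0 := BTData (bt_type m A B) (fun i => bt_lattice (B i))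
  (fun i => bt_lattice (A i.+1)).

Lemma point_bt_index :
  [/\ bt_type m A B !=set0 -> bt_index m h T0, stratum m T0 A B &
    forall T, bt_index m h T -> stratum m T A B -> bt_le m T0 T].
Proof.
unshelve epose proof (@point_strata (Wq2 D) (Wk D) (Fq2 D) (Fk D) (bk D) (witt_map D)
  (@tofrac (Wq2 D)) (@ik p D) (frac_map D) (@iq2 p D) (resE (bE D))
  (witt_red (Wq2 D)) (witt_alg (Wq2 D) (unif D))
  (witt_alg (Wk D) (unif D)) (witt_red (Wk D)) (#|resF D| * #|resF D|)%N
  (wsigma D \o wsigma D) (sigma D \o sigma D) (@ik_inj p D) (@iq2E p D)
  (fun=> erefl) (witt_map_alg (unif D)) (strict_Wq2 D) (strict_Wk D) (@bpi_clear p D)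
  _ _ _ _ _ _ _ (Nk N) tauN (Nk0 N) _ _ (wsigma D) (sigma D) hermN n
  _ _ _ _ _ _ _ _ r b full m h A B m_gt0
  _ _ _ _ _ _) as H.
- by rewrite /= !wsigma_alg.
- by move=> a; rewrite /= !sigma_ik.
- exact_no_check (@frob2_red p D).
- exact_no_check scalars_fixed.
- exact_no_check fixk.
- exact_no_check (@frob2_root p D).
- by rewrite muln_gt0 q_gt0.
- exact_no_check (slope0_opD (bpi_neq0 D) (sigma_bpi D) (@Fr_semilinear _ _ _ N)).
- exact_no_check tauZ.
- exact_no_check (@sigma_ik p D).
- exact_no_check (sigma_bpi D).
- exact_no_check (@sesquiDl (Fk D) (Nk N) (iq2 (delta D)) (Fr N) (@pairing p D n N)
    (@pairing_linear_l p D n N)).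
- exact_no_check (@sesquiZl (Fk D) (Nk N) (iq2 (delta D)) (Fr N) (@pairing p D n N)
    (@pairing_linear_l p D n N)).
- exact_no_check (@sesquiDr (Fk D) (Nk N) (iq2 (delta D)) (Fr N) (@pairing p D n N)
    (@pairing_linear_r p D n N)).
- exact_no_check (@sesquiZr (Fk D) (Nk N) (sigma D) (iq2 (delta D)) (Fr N)
    (@pairing p D n N) (@Fr_semilinear p D n N) (@pairing_linear_r p D n N)).
- exact_no_check (@eigen_submod (Fk D) (Nk N) (bE D) (@act p D n N)
    (fun a => frac_map D (phi0 D a))).
- exact_no_check (@Nk0_basis_size p D p_prime p_odd n N).
- exact_no_check (point_lattice AB).
- exact_no_check (point_A AB).
- exact_no_check (point_B AB).
- exact_no_check (point_dualA AB).
- exact_no_check (point_dualB AB).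
- exact_no_check (point_h AB).
destruct H as [[H1 H2 H3] [H4 H5 H6] [H7 H8 H9] H10].
have type_le i : bt_type m A B i -> (i <= m)%N by exact_no_check (H1 i).
have ge1 i : bt_type m A B i -> i <> 0%N -> (1 <= i <= m)%N.
  by move=> /type_le im /eqP i0; rewrite lt0n i0.
have ge1S i : bt_type m A B i -> i <> m -> (1 <= i.+1 <= m)%N.
  by move=> /type_le im /eqP ni; rewrite /= ltn_neqAle ni.
split.
- move=> ne; split.
  + exact: type_le.
  + exact: ne.
  + exact_no_check H2.
  + exact_no_check H3.
  + exact_no_check H4.
  + exact_no_check H5.
  + exact_no_check H6.
  + by move=> i l _ /type_le lm il _; exact_no_check (H7 i l il lm).
- split=> i ti i0; first exact_no_check (H8 i (ge1 i ti i0)).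
  exact_no_check (H9 i.+1 (ge1S i ti i0)).
move=> T idx [S0 S1]; unshelve epose proof (H10 (supp T) (L0 T) (L1 T) _ _ _ _ _ _) as H.
- exact_no_check (bti_sub idx).
- move=> i Ti i0; have [v _] := bti_L0 idx Ti i0; exact_no_check v.
- move=> i Ti i0; have [v _] := bti_L1 idx Ti i0; exact_no_check v.
- exact_no_check (bti_same idx).
- exact_no_check S0.
- exact_no_check S1.
exact_no_check H.
Qed.

End FullBasis.

End Strata.

Theorem lemma4p2
  (p : nat) (p_prime : prime p) (p_odd : odd p)
  (D : base_data p)
  (n m : nat) (n_gt0 : (0 < n)%N) (m_gt0 : (0 < m)%N)
  (h : nat -> nat)
  (h_incr : forall i j, (1 <= i)%N -> (i < j)%N -> (j <= m)%N -> (h i < h j)%N)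
  (h_le : forall i, (1 <= i <= m)%N -> (h i <= n)%N)
  (h_parity : forall i j, (1 <= i <= m)%N -> (1 <= j <= m)%N ->
     odd (h i) = odd (h j))
  (N : isocrystal D n) (X : framing m h N)
  (T : bt_data N) (T_index : bt_index m h T)
  (A B : nat -> set N) (AB_point : is_point m h A B) :
  open_stratum m h T A B <->
  [/\ supp T = bt_type m A B,
      (forall i, supp T i -> i <> 0%N -> L0 T i = bt_lattice (B i)) &
      (forall j, supp T j -> j <> m -> L1 T j = bt_lattice (A j.+1))].
Proof.
pose T0 := BTData (bt_type m A B) (fun i => bt_lattice (B i))
  (fun i => bt_lattice (A i.+1)).
pose comparable := [/\ bt_type m A B !=set0 -> bt_index m h T0, stratum m T0 A B &
  forall T', bt_index m h T' -> stratum m T' A B -> bt_le m T0 T'].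
have compare (L M : set N) : is_lattice_C L -> is_lattice_k M ->
    M `<=` lattice_k L -> comparable.
  move=> LC Mk ML; have [r [b full]] := full_basis_exists LC Mk ML.
  exact: (point_bt_index p_prime p_odd n_gt0 m_gt0 AB_point full).
have lat i : supp T i -> (i <> 0%N -> (1 <= i <= m)%N) /\ (i <> m -> (1 <= i.+1 <= m)%N).
  move=> /(bti_sub T_index) im; split=> /eqP ni; first by rewrite lt0n ni.
  by rewrite /= ltn_neqAle ni.
have [i Ti] := bti_nonempty T_index; have [im im1] := lat i Ti.
(* One element [i] of the support suffices: as [m > 0], it differs from 0 or from [m], so the index
   supplies a lattice of [C] covering [B i] or [A i.+1]. *)
have cover : (i <> 0%N -> B i `<=` lattice_k (L0 T i)) ->
    (i <> m -> A i.+1 `<=` lattice_k (L1 T i)) -> comparable.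
  move=> HB HA; have [i0|/eqP i0] := eqVneq i 0%N.
    have ni : i <> m by move=> E; move: m_gt0; rewrite -E i0.
    have [[LC _ _] _] := bti_L1 T_index Ti ni.
    exact: compare LC (point_lattice AB_point (im1 ni)).1 (HA ni).
  have [[LC _ _] _] := bti_L0 T_index Ti i0.
  exact: compare LC (point_lattice AB_point (im i0)).2 (HB i0).
split.
  case=> -[S0 S1] not_smaller.
  have [T0_index T0_stratum T0_min] := cover (S0 i Ti) (S1 i Ti).
  have le := T0_min T T_index (conj S0 S1).
  have ne : bt_type m A B !=set0 by exists i; case: le => + _ _; apply.
  have [E EL0 EL1] : bt_eq m T0 T.
    by apply: contrapT => neq; apply: not_smaller; exists T0; split=> //; exact: T0_index.
  by split=> [|l Tl l0|l Tl lm]; [|rewrite -EL0|rewrite -EL1].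
case=> E EL0 EL1.
(* The lattices of an index are genuine lattices of [C]; by the assumed equalities so are the hulls,
   which therefore cover the point. *)
have coverB l : supp T l -> l <> 0%N -> B l `<=` lattice_k (L0 T l).
  move=> Tl l0; have [[LC _ _] _] := bti_L0 T_index Tl l0; move: LC; rewrite EL0 //.
  exact: bt_lattice_cover (point_lattice AB_point ((lat l Tl).1 l0)).2.
have coverA l : supp T l -> l <> m -> A l.+1 `<=` lattice_k (L1 T l).
  move=> Tl lm; have [[LC _ _] _] := bti_L1 T_index Tl lm; move: LC; rewrite EL1 //.
  exact: bt_lattice_cover (point_lattice AB_point ((lat l Tl).2 lm)).1.
have [_ _ T0_min] := cover (coverB i Ti) (coverA i Ti).
split; first by split.
case=> T' [T'_index [[sTT' le0 le1] neq] T'_stratum]; apply: neq.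
have [T0T' le0' le1'] := T0_min T' T'_index T'_stratum.
(* [T'] is squeezed: it lies below [T], and the index of the point, which agrees with [T], lies
   below [T']. *)
have sE : supp T' = supp T by apply/seteqP; split=> // l /T0T'; rewrite E.
split=> // [l Tl l0|l Tl lm]; apply/seteqP; split.
- exact: le0.
- by rewrite EL0 //; apply: le0' => //; rewrite sE.
- exact: le1.
- by rewrite EL1 //; apply: le1' => //; rewrite sE.
Qed.
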